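(* Let $n_1,n_2$ be positive integers, $\mathcal N>n_1+n_2$, $R_1,R_2>0$ and $K_1,K_2\in\mathbb R$. There exists a constant $\eta^{\mathcal N}$, depending only on $\mathcal N$ and $n_i,R_i,K_i$ ($i=1,2$), such that the following holds. Let $(B,g_B,e^{-\Phi}\mathrm{dvol}_{g_B})$ and $(F,g_F,e^{-\Psi}\mathrm{dvol}_{g_F})$ be weighted Riemannian manifolds of dimensions $n_1$ and $n_2$, let $\alpha:F\to(0,\infty)$, $\beta:B\to(0,\infty)$ be smooth, $a=\ln\alpha$, $b=\ln\beta$, and consider the $(R_1,R_2)$-doubly warped product $B\,{}_\alpha^{R_1}\times_\beta^{R_2}F=(B\times F,g,e^{-\chi}\mathrm{dvol}_g)$. Let $(x,p)\in B\times F$, write $\alpha=\alpha(p)$, $\beta=\beta(x)$, and let $\mathcal K^{\mathcal N}_B,\mathcal K^{\mathcal N}_F\in\mathbb R$. If $${}^B\mathrm{Ric}^{\mathcal N}_\Phi\ge(n_1-1)\mathcal K_B^{\mathcal N}g_B\ \text{ at }x,\qquad {}^F\mathrm{Ric}^{\mathcal N}_\Psi\ge(n_2-1)\mathcal K_F^{\mathcal N}g_F\ \text{ at }p,$$ and $$R_2\,{}^B\nabla^2b\le\eta^{\mathcal N}(\nabla\Phi)^2+\eta^{\mathcal N}(\nabla b)^2\ \text{ on }UT_xB,\qquad R_1\,{}^F\nabla^2a\le\eta^{\mathcal N}(\nabla\Psi)^2+\eta^{\mathcal N}(\nabla a)^2\ \text{ on }UT_pF,$$ then at $(x,p)$ $$\mathrm{Ric}^{\mathcal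 N}_\chi\ge\min\big\{(n_1-1)\alpha^{-2}\mathcal K^{\mathcal N}_B,\ (n_2-1)\beta^{-2}\mathcal K^{\mathcal N}_F\big\}\,g.$$
   Context: A weighted Riemannian manifold $(M^n,g,e^{-\Phi}\mathrm{dvol}_g)$ is a complete $n$-dimensional Riemannian manifold with a smooth function $\Phi:M\to\mathbb R$. For $\mathcal N>n$ its $\mathcal N$-Bakry-\'Emery Ricci tensor is $\mathrm{Ric}^{\mathcal N}_\Phi=\mathrm{Ric}+\nabla^2\Phi-(\mathcal N-n)^{-1}\nabla\Phi\otimes\nabla\Phi$. The $(R_1,R_2)$-doubly warped product of $(B^{n_1},g_B,e^{-\Phi}\mathrm{dvol}_{g_B})$ and $(F^{n_2},g_F,e^{-\Psi}\mathrm{dvol}_{g_F})$ with warping functions $\alpha:F\to(0,\infty)$, $\beta:B\to(0,\infty)$ is $B\,{}_\alpha^{R_1}\times_\beta^{R_2}F=(B\times F,\ g=\alpha^2g_B\oplus\beta^2g_F,\ e^{-\chi}\mathrm{dvol}_g)$ with $e^{-\chi}=\alpha^{R_1-n_1}\beta^{R_2-n_2}e^{-\Phi}e^{-\Psi}$, i.e. $\chi=(n_1-R_1)a+(n_2-R_2)b+\Phi+\Psi$ where $a=\ln\alpha$, $b=\ln\beta$. A left superscript $B$ or $F$ means the quantity is computed in $(B,g_B)$ or $(F,g_F)$; without it, it is computed in the product. $UT_xB$ (resp. $UT_pF$) is the set of $g_B$-unit vectors in $T_xB$ (resp. $g_F$-unit vectors in $T_pF$). Inequalities between quadratic forms on $UT_xB$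 are tested on every $X\in UT_xB$: ${}^B\nabla^2b$ means ${}^B\nabla^2b(X,X)$, $(\nabla b)^2$ means $(\nabla_Xb)^2$ and $(\nabla\Phi)^2$ means $(\nabla_X\Phi)^2$; similarly on $UT_pF$. *)

(* Defs.v *)
(* MathComp-Analysis: smooth manifolds are given by an atlas, and curvature is
   computed by the usual formulas in the coordinates of a chart. *)
From HB Require Import structures.
From mathcomp Require Import all_boot all_order all_algebra.
From mathcomp Require Import all_classical all_reals all_analysis.

Set Implicit Arguments.
Unset Strict Implicit.
Unset Printing Implicit Defensive.

Import Order.TTheory GRing.Theory Num.Theory.
Import numFieldNormedType.Exports.

Local Open Scope classical_set_scope.
Local Open Scope ring_scope.

Section Coordinates.
Context {R : realType} {n : nat}.
Implicit Types (f : 'rV[R]_n -> R) (G : 'rV[R]_n -> 'M[R]_n) (y : 'rV[R]_n).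

Definition pd (i : 'I_n) f : 'rV[R]_n -> R :=
  fun y => 'D_(delta_mx ord0 i) f y.

(* C^infinity: all iterated partial derivatives exist and are continuous. *)
Definition smooth_on (U : set 'rV[R]_n) f : Prop :=
  forall (s : seq 'I_n) y, U y ->
    {for y, continuous (foldr pd f s)} /\
    (forall i, derivable (foldr pd f s) y (delta_mx ord0 i)).

(* Gamma^k_{ij} *)
Definition christoffel G (k i j : 'I_n) : 'rV[R]_n -> R := fun y =>
  2^-1 * \sum_l invmx (G y) k l *
    (pd i (fun z => G z j l) y + pd j (fun z => G z i l) y
     - pd l (fun z => G z i j) y).

(* The l-th component of Rm(d_i, d_j) d_k, where
   Rm(X, Y) Z = nabla_X nabla_Y Z - nabla_Y nabla_X Z - nabla_[X,Y] Z. *)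
Definition riemann_tensor G (l k i j : 'I_n) : 'rV[R]_n -> R := fun y =>
  pd i (christoffel G l j k) y - pd j (christoffel G l i k) y
  + \sum_m (christoffel G l i m y * christoffel G m j k y
            - christoffel G l j m y * christoffel G m i k y).

(* Ric(Y, Z) = trace of X |-> Rm(X, Y) Z. *)
Definition ricci_mx G y : 'M[R]_n :=
  \matrix_(j, k) \sum_i riemann_tensor G i k i j y.

Definition hessian_mx G f y : 'M[R]_n :=
  \matrix_(i, j) (pd i (pd j f) y - \sum_k christoffel G k i j y * pd k f y).

Definition qform (A : 'M[R]_n) (v : 'rV[R]_n) : R :=
  (v *m A *m v^T) ord0 ord0.

End Coordinates.

(* The bare data of a manifold with an atlas and a metric. The parametrization
   inv_map c is the inverse of chart_map c; it is a total function whose values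
   matter only on the image of the chart. metric c y is the Gram matrix of the
   metric in the coordinate frame of c, as a function of the coordinates y. The
   axioms are in [riemannian]. *)
Record manifold (R : realType) (n : nat) := Manifold {
  point :> topologicalType;
  chart : Type;
  chart_dom : chart -> set point;
  chart_map : chart -> point -> 'rV[R]_n;
  inv_map : chart -> 'rV[R]_n -> point;
  metric : chart -> 'rV[R]_n -> 'M[R]_n
}.

Arguments chart_dom {R n} _ _ _.
Arguments chart_map {R n} _ _ _.
Arguments inv_map {R n} _ _ _.
Arguments metric {R n} _ _ _.

Section Manifolds.
Context {R : realType} {n : nat}.
Variable M : manifold R n.

Definition chart_im (c : chart M) : set 'rV[R]_n :=
  chart_map M c @` chart_dom M c.

Definition in_chart (c : chart M) (f : M -> R) : 'rV[R]_n -> R :=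
  f \o inv_map M c.

Definition transition (c d : chart M) : 'rV[R]_n -> 'rV[R]_n :=
  chart_map M d \o inv_map M c.

(* Row i is the derivative in the i-th direction, so that components of tangent
   vectors, which are rows, change by v |-> v *m transition_jac. *)
Definition transition_jac (c d : chart M) (y : 'rV[R]_n) : 'M[R]_n :=
  \matrix_(i, j) pd i (fun z => transition c d z ord0 j) y.

Definition smooth_manifold : Prop :=
  hausdorff_space M /\ @second_countable M /\
  (forall x, exists c, chart_dom M c x) /\
  (forall c,
     [/\ open (chart_dom M c), open (chart_im c),
         forall x, chart_dom M c x -> inv_map M c (chart_map M c x) = x,
         {in chart_dom M c, continuous (chart_map M c)} &
         {in chart_im c, continuous (inv_map M c)}]) /\
  (forall c d (j : 'I_n),
     smooth_on (chart_map M c @` (chart_dom M c `&` chart_dom M d))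
               (fun y => transition c d y ord0 j)).

Definition riemannian_metric : Prop :=
  (forall c (i j : 'I_n), smooth_on (chart_im c) (fun y => metric M c y i j)) /\
  (forall c y, chart_im c y -> (metric M c y)^T = metric M c y) /\
  (forall c y v, chart_im c y -> v != 0 -> 0 < qform (metric M c y) v) /\
  (forall c d x, chart_dom M c x -> chart_dom M d x ->
     let y := chart_map M c x in
     metric M c y = transition_jac c d y *m metric M d (chart_map M d x)
                    *m (transition_jac c d y)^T).

Definition riemannian : Prop := smooth_manifold /\ riemannian_metric.

Definition smooth (f : M -> R) : Prop :=
  forall c, smooth_on (chart_im c) (in_chart c f).

(* A tangent vector at x is given by its components in some chart around x.
   (c, v) and (d, v *m transition_jac c d) represent the same vector; the
   quotient is not formed, as everything below is invariantly defined. *)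
Record tangent (x : M) := Tangent {
  tchart : chart M;
  tchart_dom : chart_dom M tchart x;
  tcomp : 'rV[R]_n
}.

Section AtPoint.
Variables (x : M).
Implicit Types X : tangent x.

Let base X : 'rV[R]_n := chart_map M (tchart X) x.

(* g(X, X) *)
Definition g_sq X : R := qform (metric M (tchart X) (base X)) (tcomp X).

Definition unit_tangent X : Prop := g_sq X = 1.

(* nabla_X f *)
Definition dirder (f : M -> R) X : R :=
  \sum_i tcomp X ord0 i * pd i (in_chart (tchart X) f) (base X).

(* (nabla^2 f)(X, X) *)
Definition hess (f : M -> R) X : R :=
  qform (hessian_mx (metric M (tchart X)) (in_chart (tchart X) f) (base X))
        (tcomp X).

(* Ric(X, X) *)
Definition ric X : R :=
  qform (ricci_mx (metric M (tchart X)) (base X)) (tcomp X).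

(* Ric^N_Phi(X, X) *)
Definition bakry_emery (N : R) (Phi : M -> R) X : R :=
  ric X + hess Phi X - (N - n%:R)^-1 * dirder Phi X ^+ 2.

End AtPoint.

Definition geodesic (gam : R -> M) : Prop :=
  continuous gam /\
  forall (t : R) (c : chart M), chart_dom M c (gam t) ->
    let u (k : 'I_n) (s : R) : R := chart_map M c (gam s) ord0 k in
    forall k : 'I_n,
      [/\ derivable (u k) t 1, derivable (derive1 (u k)) t 1 &
          derive1 (derive1 (u k)) t +
          \sum_i \sum_j christoffel (metric M c) k i j (chart_map M c (gam t))
                        * derive1 (u i) t * derive1 (u j) t = 0].

(* Every tangent vector is the initial velocity of a geodesic defined for all
   times. *)
Definition complete : Prop :=
  forall (x : M) (X : tangent x), exists gam : R -> M,
    [/\ geodesic gam, gam 0 = x &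
        forall k : 'I_n,
          derive1 (fun s => chart_map M (tchart X) (gam s) ord0 k) 0
          = tcomp X ord0 k].

Definition weighted_riemannian (Phi : M -> R) : Prop :=
  [/\ riemannian, complete & smooth Phi].

End Manifolds.

Arguments smooth {R n M} f.
Arguments g_sq {R n M x} X.
Arguments unit_tangent {R n M x} X.
Arguments dirder {R n M x} f X.
Arguments hess {R n M x} f X.
Arguments ric {R n M x} X.
Arguments bakry_emery {R n M x} N Phi X.
Arguments weighted_riemannian {R n} M Phi.

Section DoublyWarped.
Context {R : realType} {n1 n2 : nat}.
Variables (B : manifold R n1) (F : manifold R n2).
Variables (alpha : F -> R) (beta : B -> R).

(* B x F with the product atlas and the metric alpha^2 g_B (+) beta^2 g_F. *)
Definition doubly_warped : manifold R (n1 + n2) :=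
  @Manifold R (n1 + n2) (B * F)%type (chart B * chart F)%type
    (fun c => chart_dom B c.1 `*` chart_dom F c.2)
    (fun c z => row_mx (chart_map B c.1 z.1) (chart_map F c.2 z.2))
    (fun c y => (inv_map B c.1 (lsubmx y), inv_map F c.2 (rsubmx y)))
    (fun c y => block_mx
       (alpha (inv_map F c.2 (rsubmx y)) ^+ 2 *: metric B c.1 (lsubmx y)) 0
       0 (beta (inv_map B c.1 (lsubmx y)) ^+ 2 *: metric F c.2 (rsubmx y))).

(* exp (- chi) = alpha^(R1 - n1) beta^(R2 - n2) exp (- Phi) exp (- Psi) *)
Definition warped_weight (R1 R2 : R) (Phi : B -> R) (Psi : F -> R)
    : doubly_warped -> R :=
  fun z => (n1%:R - R1) * ln (alpha z.2) + (n2%:R - R2) * ln (beta z.1)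
           + Phi z.1 + Psi z.2.

End DoublyWarped.

Arguments doubly_warped {R n1 n2} B F alpha beta.
Arguments warped_weight {R n1 n2} B F alpha beta R1 R2 Phi Psi z.

(* Main.v *)
(* In a product chart the Christoffel symbols of the metric
   alpha^2 g_B (+) beta^2 g_F express its Ricci tensor and the Hessian of chi
   through those of the factors. With X tangent to B, U tangent to F,
   a = ln alpha and b = ln beta, the B-block of Ric + nabla^2 chi is
     Ric_B + nabla^2 Phi - R2 nabla^2 b - n2 db (x) db
       - (alpha^2 / beta^2) (lap a + R1 |grad a|^2 - <grad a, grad Psi>) g_B,
   and the mixed terms and (d chi)^2 are quadratic in Xb, X Phi, Ua, U Psi only.
   For eta very negative, tracing the bound on nabla^2 a over an orthonormal
   frame makes the bracket nonpositive, and - R2 nabla^2 b dominates all terms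
   quadratic in Xb and X Phi; likewise on F. *)
Require Import Defs.
From HB Require Import structures.
From mathcomp Require Import all_boot all_order all_algebra.
From mathcomp Require Import all_classical all_reals all_analysis.
From mathcomp Require Import ring lra.

Set Implicit Arguments.
Unset Strict Implicit.
Unset Printing Implicit Defensive.

Import Order.TTheory GRing.Theory Num.Theory.
Import numFieldNormedType.Exports.

Local Open Scope ring_scope.

(** * Partial derivatives, as a relation asserting existence together with the value *)

Section PartialDerivatives.
Context {R : realType} {n : nat}.
Implicit Types (f g : 'rV[R]_n -> R) (y : 'rV[R]_n) (i : 'I_n).

(** The factor [alpha^2 / beta^2] in front of the bracket is not controlled by the hypotheses, and
    eta may depend on neither warping function. The bracket therefore cannot be absorbed into
    quadratic terms; it must have a sign. For this reason each Hessian bound is used twice. Traced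
    over a frame, the bound on a discards the bracket in the B-block; evaluated at U itself, it
    supplies in the F-block a positive multiple of (U Psi)^2 + (U a)^2. The bound on b acts likewise
    with the factors exchanged. The two positive multiples together absorb the mixed terms, which
    involve first derivatives only.

    The coefficients R_i come from the weight: the Ricci tensor alone has n_2 nabla^2 b and n_1
    |grad a|^2, and the terms (n_i - R_i) of chi replace n_i by R_i there.

    Three upper bounds on eta result: -(R_1^2 + R_1) and -(R_2^2 + R_2) for the signs of the two
    brackets, and one from Young's inequality for the mixed terms. As all three are nonpositive,
    their sum satisfies each of them. *)

Definition is_pd i f y (d : R) := is_derive y (delta_mx ord0 i) f d.

Lemma is_pdE i f y d : is_pd i f y d -> pd i f y = d.
Proof. by case. Qed.

Lemma is_pdP i f y : derivable f y (delta_mx ord0 i) -> is_pd i f y (pd i f y).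
Proof. exact: derivableP. Qed.

Lemma is_pd_cst i c y : is_pd i (fun=> c) y 0.
Proof. exact: is_derive_cst. Qed.

Lemma is_pdD i f g y df dg : is_pd i f y df -> is_pd i g y dg ->
  is_pd i (fun z => f z + g z) y (df + dg).
Proof. exact: is_deriveD. Qed.

Lemma is_pdM i f g y df dg : is_pd i f y df -> is_pd i g y dg ->
  is_pd i (fun z => f z * g z) y (f y * dg + df * g y).
Proof. by move=> ff gg; rewrite [df * _]mulrC; exact: is_deriveM. Qed.

Lemma is_pdMl i c f y df : is_pd i f y df -> is_pd i (fun z => c * f z) y (c * df).
Proof.
by move=> ff; have := is_pdM (is_pd_cst i c y) ff; rewrite mul0r addr0.
Qed.

Lemma is_pdMr i c f y df : is_pd i f y df -> is_pd i (fun z => f z * c) y (df * c).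
Proof.
by move=> ff; have := is_pdM ff (is_pd_cst i c y); rewrite mulr0 add0r.
Qed.

Lemma is_pd_sum (I : finType) i (f : I -> 'rV[R]_n -> R) y (df : I -> R) :
  (forall k, is_pd i (f k) y (df k)) ->
  is_pd i (fun z => \sum_k f k z) y (\sum_k df k).
Proof.
move=> ff; rewrite /is_pd -fct_sumE.
elim/big_ind2 : _ => [|d1 f1 d2 f2 ? ?|k _]; last exact: ff.
  exact: is_derive_cst.
exact: is_deriveD.
Qed.

(** Only a partial derivative of [f] at [y] is known, not differentiability, so the chain rule is
    applied to the restriction [phi] of [f] to the coordinate line through [y]. *)
Lemma is_pd_ln i f y df : 0 < f y -> is_pd i f y df ->
  is_pd i (fun z => ln (f z)) y (df / f y).
Proof.
move=> f0 ff.
have [/derivable1P dl dE] := ff.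
pose phi h : R := f (h *: delta_mx ord0 i + y).
have phi0 : phi 0 = f y by rewrite /phi scale0r add0r.
rewrite /is_pd; have dln : derivable (@ln R) (phi 0) 1.
  by rewrite phi0; exact: (@ex_derive _ _ _ _ _ _ _ (is_derive1_ln f0)).
apply: DeriveDef.
  apply/derivable1P/derivable1_diffP.
  by apply: (@differentiable_comp _ _ _ _ phi); apply/derivable1_diffP.
have slice (h : 'rV[R]_n -> R) : 'D_(delta_mx ord0 i) h y
    = (fun t => h (t *: delta_mx ord0 i + y))^`()%classic 0.
  rewrite derive1E /derive; set g1 := fun t => _; set g2 := fun t => _.
  suff -> : g1 = g2 by [].
  by rewrite funeqE /g1 /g2 => t /=; rewrite scale0r add0r addr0 [_%:A]mulr1.
rewrite slice (derive1_comp (f := phi) (g := @ln R)) // -(slice f).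
rewrite dE.
rewrite phi0 derive1E (@derive_val _ _ _ _ _ _ _ (is_derive1_ln f0)).
by rewrite mulrC.
Qed.

Lemma near_eq_pd i f g y : (\forall z \near y, f z = g z) -> pd i f y = pd i g y.
Proof. exact: near_eq_derive. Qed.

Lemma open_eq_pd (U : set 'rV[R]_n) i f g y : open U -> U y ->
  (forall z, U z -> f z = g z) -> pd i f y = pd i g y.
Proof.
move=> oU Uy fg; apply: near_eq_pd; apply: filterS fg _.
exact: open_nbhs_nbhs.
Qed.

Lemma smooth_is_pd (U : set 'rV[R]_n) f i y : smooth_on U f -> U y ->
  is_pd i f y (pd i f y).
Proof. by move=> sf Uy; apply: is_pdP; exact: (sf [::] y Uy).2. Qed.

Lemma smooth_is_pd2 (U : set 'rV[R]_n) f i j y : smooth_on U f -> U y ->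
  is_pd i (pd j f) y (pd i (pd j f) y).
Proof. by move=> sf Uy; apply: is_pdP; exact: (sf [:: j] y Uy).2. Qed.

Lemma derivable_prod (I : Type) (r : seq I) (P : pred I) i
    (f : I -> 'rV[R]_n -> R) y :
  (forall k, derivable (f k) y (delta_mx ord0 i)) ->
  derivable (fun z => \prod_(k <- r | P k) f k z) y (delta_mx ord0 i).
Proof.
move=> df; elim: r => [|k r ih].
  under eq_fun do rewrite big_nil; exact: derivable_cst.
under eq_fun do rewrite big_cons; case: (P k) => //.
exact: (derivableM (df k) ih).
Qed.

Lemma derivable_det m i (A : 'rV[R]_n -> 'M[R]_m) y :
  (forall k l, derivable (fun z => A z k l) y (delta_mx ord0 i)) ->
  derivable (fun z => \det (A z)) y (delta_mx ord0 i).
Proof.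
move=> dA; rewrite /determinant.
apply: ex_derive; apply: is_pd_sum => s; apply: is_pdMl; apply: is_pdP.
by apply: derivable_prod => k; exact: dA.
Qed.

(** Cramer's rule reduces this to determinants, which are polynomial in the entries. Invertibility
    is asked near [y] because [invmx] is the identity map on singular matrices. *)
Lemma derivable_invmx m i (A : 'rV[R]_n -> 'M[R]_m) y :
  (\forall z \near y, A z \in unitmx) ->
  (forall k l, derivable (fun z => A z k l) y (delta_mx ord0 i)) ->
  forall k l, derivable (fun z => invmx (A z) k l) y (delta_mx ord0 i).
Proof.
move=> uA dA k l.
have Ay : \det (A y) != 0.
  by have := nbhs_singleton uA; rewrite unitmxE unitfE.
apply: (@near_eq_derivable _ _ _
    (fun z => (\det (A z))^-1 * cofactor (A z) l k)).
  by apply: filterS uA => z Az; rewrite /invmx Az !mxE.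
apply: (@derivableM _ _ (fun z => (\det (A z))^-1) (fun z => cofactor (A z) l k)).
  by apply: derivableV => //; exact: derivable_det.
apply: ex_derive; apply: is_pdMl; apply: is_pdP; apply: derivable_det => p q.
by under eq_fun do rewrite !mxE; exact: dA.
Qed.

(** The formula d(A^-1) = - A^-1 (dA) A^-1, obtained by differentiating A^-1 A = 1, an identity that
    holds in a whole neighbourhood of [y]. *)
Lemma is_pd_invmx m i (A : 'rV[R]_n -> 'M[R]_m) y :
  (\forall z \near y, A z \in unitmx) ->
  (forall k l, derivable (fun z => A z k l) y (delta_mx ord0 i)) ->
  forall k l, is_pd i (fun z => invmx (A z) k l) y
    (- (invmx (A y) *m (\matrix_(p, q) pd i (fun z => A z p q) y)
        *m invmx (A y)) k l).
Proof.
move=> uA dA k l.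
pose dV : 'M[R]_m := \matrix_(p, q) pd i (fun z => invmx (A z) p q) y.
pose dM : 'M[R]_m := \matrix_(p, q) pd i (fun z => A z p q) y.
have Ay : A y \in unitmx by exact: nbhs_singleton uA.
have isV p q : is_pd i (fun z => invmx (A z) p q) y (dV p q).
  by rewrite mxE; apply: is_pdP; exact: derivable_invmx.
have isA p q : is_pd i (fun z => A z p q) y (dM p q).
  by rewrite mxE; apply: is_pdP; exact: dA.
suff VE : dV = - (invmx (A y) *m dM *m invmx (A y)).
  by have := isV k l; rewrite VE mxE.
suff : dV *m A y = - (invmx (A y) *m dM).
  by move=> /(congr1 (mulmx^~ (invmx (A y)))); rewrite /= mulmxK // mulNmx.
apply/eqP; rewrite -addr_eq0; apply/eqP/matrixP => p q.
have H : is_pd i (fun z => (invmx (A z) *m A z) p q) y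
    (\sum_j (invmx (A y) p j * dM j q + dV p j * A y j q)).
  under [X in is_pd _ X]eq_fun do rewrite mxE.
  by apply: is_pd_sum => j; exact: is_pdM.
rewrite !mxE -big_split /= (eq_bigr _ (fun j _ => addrC _ _)).
rewrite -(is_pdE H) (@near_eq_pd i _ (fun=> (1%:M : 'M[R]_m) p q)).
  exact: is_pdE (is_pd_cst _ _ _).
by apply: filterS uA => z Az; rewrite mulVmx.
Qed.

End PartialDerivatives.

(** * Orthonormal frames and traces with respect to a metric *)

Section OrthonormalFrames.
Context {R : realType}.

Definition posdef n (G : 'M[R]_n) : Prop :=
  G^T = G /\ forall v, v != 0 -> 0 < qform G v.

Lemma qformE n (A : 'M[R]_n) v :
  qform A v = \sum_i \sum_j v ord0 i * A i j * v ord0 j.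
Proof.
rewrite /qform !mxE exchange_big /=; apply: eq_bigr => j _.
by rewrite !mxE mulr_suml; apply: eq_bigr.
Qed.

Lemma posdef_ge0 n (G : 'M[R]_n) v : posdef G -> 0 <= qform G v.
Proof.
move=> [_ G0]; have [->|v0] := eqVneq v 0; last exact/ltW/G0.
by rewrite /qform mul0mx mul0mx mxE.
Qed.

(* Split off the first basis vector and apply induction to its orthogonal
   complement, spanned by the rows of [J]. *)
Lemma orthonormal_frame n (G : 'M[R]_n) : posdef G ->
  exists P : 'M[R]_n, P *m G *m P^T = 1%:M.
Proof.
elim: n G => [|n IH] G [symG posG]; first by exists 0; apply/matrixP => -[].
move: G symG posG; rewrite -[n.+1]/(1 + n)%N => G symG posG.
pose e : 'rV[R]_(1 + n) := row_mx 1%:M 0.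
pose g := qform G e.
have g0 : 0 < g.
  by apply: posG; rewrite row_mx_eq0 oner_eq0.
pose w : 'cV[R]_n := dlsubmx G.
have eGeE : e *m G *m e^T = g%:M by rewrite [LHS]mx11_scalar.
have ulE : ulsubmx G = g%:M.
  rewrite -eGeE -[in RHS](submxK G) /e mul_row_block tr_row_mx mul_row_col.
  by rewrite !mul1mx !mul0mx !addr0 trmx0 mulmx0 addr0 trmx1 mulmx1.
(* Each row is one of the remaining basis vectors minus its component along [e]; the column [w]
   holds the inner products with [e]. *)
pose J : 'M[R]_(n, 1 + n) := row_mx (- g^-1 *: w) 1%:M.
have JGe : J *m G *m e^T = 0.
  rewrite -(submxK G) ulE /J mul_row_block tr_row_mx mul_row_col.
  rewrite trmx0 mulmx0 addr0 trmx1 mulmx1 mul1mx -/w.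
  by rewrite mul_mx_scalar scalerA mulrN mulfV ?gt_eqF // scaleN1r addNr.
have eGJ : e *m G *m J^T = 0.
  by apply: trmx_inj; rewrite !trmx_mul trmxK symG mulmxA JGe trmx0.
have [|P' /[!mulmxA] P'E] := IH (J *m G *m J^T).
  split; first by rewrite !trmx_mul trmxK symG mulmxA.
  move=> v v0; rewrite /qform !mulmxA -(mulmxA _ J^T) -trmx_mul.
  (* The right block of [v *m J] is [v], so this vector is nonzero. *)
  apply: posG; rewrite mul_mx_row mulmx1 row_mx_eq0 (negPf v0) andbF //.
exists (col_mx ((Num.sqrt g)^-1 *: e) (P' *m J)).
rewrite mul_col_mx tr_col_mx mul_col_row trmx_mul linearZ /= !mulmxA.
rewrite -!scalemxAl -!scalemxAr eGeE scalerA -expr2 exprVn sqr_sqrtr ?ltW //.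
rewrite eGJ mul0mx scaler0 -(mulmxA P' J) -(mulmxA P' _ e^T) JGe mulmx0 scaler0.
rewrite scale_scalar_mx mulVf ?gt_eqF // !mulmxA P'E.
by rewrite -scalar_mx_block.
Qed.

Lemma invmx_frame n (G P : 'M[R]_n) : P *m G *m P^T = 1%:M ->
  G \in unitmx /\ invmx G = P^T *m P.
Proof.
move=> PG; have uP := mulmx1_unit PG.
have E : G *m (P^T *m P) = 1%:M.
  have /mulmx1C : P *m (G *m P^T) = 1%:M by rewrite mulmxA.
  by rewrite mulmxA.
have [uG _] := mulmx1_unit E; split=> //.
by rewrite -[LHS]mulmx1 -E mulKmx.
Qed.

(** Rewrites a metric trace as a sum of values on the unit vectors of a frame, which is where the
    Hessian hypotheses can be applied. *)
Lemma trace_frame n (G P M : 'M[R]_n) : P *m G *m P^T = 1%:M ->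
  \sum_r \sum_s invmx G r s * M r s = \sum_k qform M (row k P).
Proof.
move=> /invmx_frame[_ ->].
under [RHS]eq_bigr do rewrite qformE.
rewrite [RHS]exchange_big /=; apply: eq_bigr => r _.
rewrite [RHS]exchange_big /=; apply: eq_bigr => s _.
rewrite mxE mulr_suml; apply: eq_bigr => k _.
by rewrite !mxE mulrAC.
Qed.

Lemma posdef_unit n (G : 'M[R]_n) : posdef G -> G \in unitmx.
Proof. by move=> /orthonormal_frame[P /invmx_frame[]]. Qed.

Lemma invmx_sym n (G : 'M[R]_n) : G^T = G -> forall i j, invmx G i j = invmx G j i.
Proof. by move=> sG i j; rewrite -[in LHS]sG -trmx_inv mxE. Qed.

End OrthonormalFrames.

(** * Gradient, Laplacian and divergence in one chart *)

Section MetricCalculus.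
Context {R : realType} {n : nat}.
Implicit Types (U : set 'rV[R]_n) (G : 'rV[R]_n -> 'M[R]_n) (f : 'rV[R]_n -> R).

Definition local_metric U G : Prop :=
  [/\ open U, forall y, U y -> posdef (G y)
    & forall i j, smooth_on U (fun y => G y i j)].

Definition warping U f : Prop :=
  smooth_on U f /\ forall y, U y -> 0 < f y.

Definition log f : 'rV[R]_n -> R := fun y => ln (f y).

Definition gradient G f (k : 'I_n) : 'rV[R]_n -> R := fun y =>
  \sum_s invmx (G y) k s * pd s f y.

Definition laplacian G f : 'rV[R]_n -> R := fun y =>
  \sum_r \sum_s invmx (G y) r s * hessian_mx G f y r s.

Definition gradient_dot G f h : 'rV[R]_n -> R := fun y =>
  \sum_s gradient G f s y * pd s h y.

Lemma pd_log U f i y : warping U f -> U y -> pd i (log f) y = pd i f y / f y.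
Proof.
by move=> [sf f0] Uy; apply/is_pdE/is_pd_ln; [exact: f0|exact: smooth_is_pd sf Uy].
Qed.

Lemma is_pd_log U f i y : warping U f -> U y ->
  is_pd i (log f) y (pd i (log f) y).
Proof.
move=> wf Uy; rewrite (pd_log _ wf Uy).
by case: wf => sf f0; apply: is_pd_ln; [exact: f0|exact: smooth_is_pd sf Uy].
Qed.

Lemma is_pd2_log U f i j y : open U -> warping U f -> U y ->
  is_pd i (pd j (log f)) y (pd i (pd j (log f)) y).
Proof.
move=> oU wf Uy; apply: is_pdP.
have nU : nbhs y U by exact: open_nbhs_nbhs.
apply: (@near_eq_derivable _ _ _ (fun z => pd j f z * (f z)^-1)).
  by apply: filterS nU => z Uz; rewrite (pd_log _ wf Uz).
have [sf f0] := wf.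
apply: (@derivableM _ _ (pd j f) (fun z => (f z)^-1)).
  by case: (smooth_is_pd2 i j sf Uy).
by apply: derivableV; [rewrite gt_eqF ?f0|case: (smooth_is_pd i sf Uy)].
Qed.

(** Stated through [log f] so that the curvature formulas involve the warping functions only through
    a, b and the squares [al ^+ 2], [be ^+ 2]. *)
Lemma is_pd_sqr U f i y : warping U f -> U y ->
  is_pd i (fun z => f z ^+ 2) y (2 * f y ^+ 2 * pd i (log f) y).
Proof.
move=> wf Uy; have [sf f0] := wf; have pf := smooth_is_pd i sf Uy.
rewrite (pd_log _ wf Uy); under [X in is_pd _ X]eq_fun do rewrite expr2.
rewrite (_ : _ * _ = f y * pd i f y + pd i f y * f y); first exact: is_pdM.
by field; rewrite gt_eqF ?f0.
Qed.

Lemma christoffel_sym U G k i j y : local_metric U G -> U y ->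
  christoffel G k i j y = christoffel G k j i y.
Proof.
move=> [oU pG _] Uy; congr (_ * _); apply: eq_bigr => l _; congr (_ * _).
rewrite (@open_eq_pd _ _ _ l _ (fun z => G z j i) _ oU Uy).
  by rewrite [X in X - _]addrC.
by move=> z /pG[sG _]; rewrite -[in LHS]sG mxE.
Qed.

Lemma sum_invmx_l U G k i y : local_metric U G -> U y ->
  \sum_m invmx (G y) k m * G y i m = (k == i)%:R.
Proof.
move=> [_ pG _] Uy; have [sG _] := pG _ Uy.
transitivity ((1%:M : 'M[R]_n) k i); last by rewrite mxE.
rewrite -(mulVmx (posdef_unit (pG _ Uy))) mxE.
apply: eq_bigr => m _; congr (_ * _).
by rewrite -[in LHS]sG mxE.
Qed.

Lemma is_pd_gradient U G f i k y : local_metric U G -> U y ->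
  (forall s, is_pd i (pd s f) y (pd i (pd s f) y)) ->
  is_pd i (gradient G f k) y (\sum_s (invmx (G y) k s * pd i (pd s f) y
     - (invmx (G y) *m (\matrix_(p, q) pd i (fun z => G z p q) y)
        *m invmx (G y)) k s * pd s f y)).
Proof.
move=> [oU pG sG] Uy df; apply: is_pd_sum => s.
rewrite -mulNr; apply: is_pdM => //; apply: is_pd_invmx.
  have nU : nbhs y U by exact: open_nbhs_nbhs.
  by apply: filterS nU => z /pG; exact: posdef_unit.
by move=> p q; case: (smooth_is_pd i (sG p q) Uy).
Qed.

Lemma sum_metric_gradient U G f j y : local_metric U G -> U y ->
  \sum_m G y j m * gradient G f m y = pd j f y.
Proof.
move=> [_ pG _] Uy.
transitivity (\sum_s (1%:M : 'M[R]_n) j s * pd s f y); last first.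
  rewrite (bigD1 j) //= big1 ?addr0 => [|s sj]; rewrite mxE ?eqxx ?mul1r //.
  by rewrite eq_sym (negPf sj) mul0r.
rewrite -(mulmxV (posdef_unit (pG _ Uy))).
under eq_bigr do rewrite mulr_sumr.
rewrite exchange_big /=; apply: eq_bigr => s _; rewrite mxE mulr_suml.
by apply: eq_bigr => m _; rewrite mulrA.
Qed.

(** The Laplacian as the divergence of the gradient, the form in which it comes out of the Ricci
    trace. With A = V^rs (d_r g_sl) grad^l f and B = V^rs (d_l g_rs) grad^l f, differentiating the
    inverse metric V gives -A and the traced Christoffel symbol gives B/2, while the Christoffel
    term of the Hessian gives -(2A - B)/2. *)
Lemma gradient_divergence U G f y : local_metric U G -> U y ->
  (forall i s, is_pd i (pd s f) y (pd i (pd s f) y)) ->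
  \sum_r pd r (gradient G f r) y
  + \sum_r \sum_s christoffel G r r s y * gradient G f s y
  = laplacian G f y.
Proof.
move=> mG Uy df; have [oU pG sG] := mG; have [symG _] := pG _ Uy.
set V := invmx (G y).
have symV i j : V i j = V j i by exact: invmx_sym.
pose D l p q := pd l (fun z => G z p q) y.
have symD l p q : D l p q = D l q p.
  apply: (open_eq_pd _ oU Uy) => z /pG[sGz _].
  by rewrite -[in LHS]sGz mxE.
pose g s := gradient G f s y.
have gE s : g s = \sum_t V s t * pd t f y by [].
have E1 : \sum_r pd r (gradient G f r) y
    = \sum_r \sum_s V r s * pd r (pd s f) y
      - \sum_r \sum_p \sum_q V r p * D r p q * g q.
  rewrite -sumrB; apply: eq_bigr => r _.
  rewrite (is_pdE (is_pd_gradient r mG Uy (df r))) sumrB; congr (_ - _).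
  transitivity (\sum_s \sum_q (\sum_p V r p * D r p q) * V q s * pd s f y).
    apply: eq_bigr => s _; rewrite mxE mulr_suml; apply: eq_bigr => q _.
    by rewrite !mxE; congr (_ * _ * _); apply: eq_bigr => p _; rewrite mxE.
  rewrite exchange_big [RHS]exchange_big /=; apply: eq_bigr => q _.
  rewrite -mulr_suml gE mulr_sumr; apply: eq_bigr => s _.
  by rewrite mulrA.
(* The contraction Gamma^r_rs is half of V^rl d_s g_rl: the other two derivatives are antisymmetric
   in r and l and vanish against the symmetric V. *)
have E2 : \sum_r \sum_s christoffel G r r s y * g s
    = 2^-1 * \sum_r \sum_l \sum_s V r l * D s r l * g s.
  have -> : \sum_r \sum_s christoffel G r r s y * g s
      = 2^-1 * \sum_r \sum_l \sum_s V r l * D s r l * g s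
      + 2^-1 * (\sum_r \sum_l \sum_s V r l * D r s l * g s
               - \sum_r \sum_l \sum_s V r l * D l r s * g s).
    rewrite -sumrB -mulrDr -big_split mulr_sumr; apply: eq_bigr => r _ /=.
    rewrite -sumrB -big_split mulr_sumr /=.
    under [LHS]eq_bigr do rewrite /christoffel -mulrA mulr_suml mulr_sumr.
    rewrite exchange_big /=; apply: eq_bigr => l _.
    rewrite -sumrB -big_split mulr_sumr /=; apply: eq_bigr => s _.
    by rewrite -/V /D; ring.
  rewrite [X in _ - X]exchange_big /= [X in _ * (_ - X)](eq_bigr (fun r =>
    \sum_l \sum_s V r l * D r s l * g s)) ?subrr ?mulr0 ?addr0 // => r _.
  apply: eq_bigr => l _; apply: eq_bigr => s _.
  by rewrite (symV l r) (symD r l s).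
rewrite E1 E2 /laplacian -/V.
have -> : \sum_r \sum_s V r s * hessian_mx G f y r s
    = \sum_r \sum_s V r s * pd r (pd s f) y
    - 2^-1 * \sum_r \sum_s \sum_l V r s * (D r s l + D s r l - D l r s) * g l.
  rewrite mulr_sumr -sumrB; apply: eq_bigr => r _.
  rewrite mulr_sumr -sumrB; apply: eq_bigr => s _.
  rewrite mxE mulrBr; congr (_ - _).
  rewrite mulr_sumr; under eq_bigr do rewrite /christoffel -mulrA mulr_suml !mulr_sumr.
  rewrite exchange_big mulr_sumr /=; apply: eq_bigr => l _.
  rewrite gE !mulr_sumr; apply: eq_bigr => k _.
  by rewrite -/V (symV k l) /D; ring.
rewrite -addrA; congr (_ + _).
have -> : \sum_r \sum_s \sum_l V r s * (D r s l + D s r l - D l r s) * g l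
   = \sum_r \sum_s \sum_l V r s * D r s l * g l
   + \sum_r \sum_s \sum_l V r s * D s r l * g l
   - \sum_r \sum_s \sum_l V r s * D l r s * g l.
  rewrite -big_split -sumrB; apply: eq_bigr => r _ /=.
  rewrite -big_split -sumrB; apply: eq_bigr => s _ /=.
  rewrite -big_split -sumrB; apply: eq_bigr => l _ /=.
  by ring.
have -> : \sum_r \sum_s \sum_l V r s * D s r l * g l
   = \sum_r \sum_s \sum_l V r s * D r s l * g l.
  rewrite exchange_big; apply: eq_bigr => r _ ; apply: eq_bigr => s _ /=.
  by apply: eq_bigr => l _; rewrite symV.
by field.
Qed.

End MetricCalculus.

(** * The doubly warped metric in a product chart *)

Section DoublyWarpedCoordinates.
Context {R : realType}.

(* The two factors play symmetric roles in the formulas below; [flip] exchanges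
   them, so that each formula is proved for one factor only. *)
Record coord_split (n m1 m2 : nat) := CoordSplit {
  inL : 'I_m1 -> 'I_n;
  inR : 'I_m2 -> 'I_n;
  join : 'rV[R]_m1 -> 'rV[R]_m2 -> 'rV[R]_n;
  sum_split : forall f : 'I_n -> R,
    \sum_k f k = \sum_i f (inL i) + \sum_p f (inR p);
  join_deltaL : forall (h : R) i y1 y2,
    join (h *: delta_mx ord0 i + y1) y2 = h *: delta_mx ord0 (inL i) + join y1 y2;
  join_deltaR : forall (h : R) p y1 y2,
    join y1 (h *: delta_mx ord0 p + y2) = h *: delta_mx ord0 (inR p) + join y1 y2
}.

Definition flip n m1 m2 (sp : coord_split n m1 m2) : coord_split n m2 m1 :=
  @CoordSplit n m2 m1 (inR sp) (inL sp) (fun y2 y1 => join sp y1 y2)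
    (fun f => etrans (sum_split sp f) (addrC _ _))
    (fun h i y1 y2 => join_deltaR sp h i y2 y1)
    (fun h i y1 y2 => join_deltaL sp h i y2 y1).

(** The splitting of indices is abstract, so no block matrix is visible from which the inverse could
    be computed; the blocks of the inverse are therefore recorded too. Both off-diagonal blocks
    appear so that exchanging the factors only permutes the fields. *)
Record warped n m1 m2 (sp : coord_split n m1 m2)
    (U1 : set 'rV[R]_m1) (U2 : set 'rV[R]_m2)
    (G1 : 'rV[R]_m1 -> 'M[R]_m1) (G2 : 'rV[R]_m2 -> 'M[R]_m2)
    (al : 'rV[R]_m2 -> R) (be : 'rV[R]_m1 -> R)
    (G : 'rV[R]_n -> 'M[R]_n) : Prop := Warped {
  metricL : local_metric U1 G1;
  metricR : local_metric U2 G2;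
  warpingL : warping U1 be;
  warpingR : warping U2 al;
  warpedLL : forall y1 y2 i j, U1 y1 -> U2 y2 ->
    G (join sp y1 y2) (inL sp i) (inL sp j) = al y2 ^+ 2 * G1 y1 i j;
  warpedRR : forall y1 y2 p q, U1 y1 -> U2 y2 ->
    G (join sp y1 y2) (inR sp p) (inR sp q) = be y1 ^+ 2 * G2 y2 p q;
  warpedLR : forall y1 y2 i p, U1 y1 -> U2 y2 ->
    G (join sp y1 y2) (inL sp i) (inR sp p) = 0;
  warpedRL : forall y1 y2 p i, U1 y1 -> U2 y2 ->
    G (join sp y1 y2) (inR sp p) (inL sp i) = 0;
  warpedVLL : forall y1 y2 i j, U1 y1 -> U2 y2 ->
    invmx (G (join sp y1 y2)) (inL sp i) (inL sp j)
      = al y2 ^- 2 * invmx (G1 y1) i j;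
  warpedVRR : forall y1 y2 p q, U1 y1 -> U2 y2 ->
    invmx (G (join sp y1 y2)) (inR sp p) (inR sp q)
      = be y1 ^- 2 * invmx (G2 y2) p q;
  warpedVLR : forall y1 y2 i p, U1 y1 -> U2 y2 ->
    invmx (G (join sp y1 y2)) (inL sp i) (inR sp p) = 0;
  warpedVRL : forall y1 y2 p i, U1 y1 -> U2 y2 ->
    invmx (G (join sp y1 y2)) (inR sp p) (inL sp i) = 0
}.

Lemma warped_flip n m1 m2 (sp : coord_split n m1 m2) U1 U2 G1 G2 al be G :
  warped sp U1 U2 G1 G2 al be G -> warped (flip sp) U2 U1 G2 G1 be al G.
Proof. by case=> *; split=> //= *; auto. Qed.

Lemma pd_joinL n m1 m2 (sp : coord_split n m1 m2) i f y1 y2 :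
  pd (inL sp i) f (join sp y1 y2) = pd i (fun z => f (join sp z y2)) y1.
Proof.
rewrite /pd /derive; set g1 := fun h => _; set g2 := fun h => _.
suff -> : g1 = g2 by [].
by rewrite funeqE /g1 /g2 => h /=; rewrite join_deltaL.
Qed.

Lemma pd_joinR n m1 m2 (sp : coord_split n m1 m2) p f y1 y2 :
  pd (inR sp p) f (join sp y1 y2) = pd p (fun z => f (join sp y1 z)) y2.
Proof. exact: (pd_joinL (flip sp)). Qed.

(** * Christoffel symbols of the warped metric *)

Section Christoffel.
Context {n m1 m2 : nat} {sp : coord_split n m1 m2}.
Context {U1 : set 'rV[R]_m1} {U2 : set 'rV[R]_m2}.
Context {G1 : 'rV[R]_m1 -> 'M[R]_m1} {G2 : 'rV[R]_m2 -> 'M[R]_m2}.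
Context {al : 'rV[R]_m2 -> R} {be : 'rV[R]_m1 -> R} {G : 'rV[R]_n -> 'M[R]_n}.
Context (W : warped sp U1 U2 G1 G2 al be G).
Context {y1 : 'rV[R]_m1} {y2 : 'rV[R]_m2} (Uy1 : U1 y1) (Uy2 : U2 y2).
Local Notation y := (join sp y1 y2).
Local Notation l := (inL sp).
Local Notation r := (inR sp).

Lemma pdL_warpedLL i j k :
  pd (l i) (fun z => G z (l j) (l k)) y
  = al y2 ^+ 2 * pd i (fun z => G1 z j k) y1.
Proof.
have [oU1 _ sG1] := metricL W.
rewrite pd_joinL (open_eq_pd _ oU1 Uy1 (fun z Uz => warpedLL W j k Uz Uy2)).
exact/is_pdE/is_pdMl/(smooth_is_pd _ (sG1 j k) Uy1).
Qed.

Lemma pdR_warpedLL p j k :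
  pd (r p) (fun z => G z (l j) (l k)) y
  = 2 * al y2 ^+ 2 * pd p (log al) y2 * G1 y1 j k.
Proof.
have [oU2 _ _] := metricR W.
rewrite pd_joinR (open_eq_pd _ oU2 Uy2 (fun z Uz => warpedLL W j k Uy1 Uz)).
exact/is_pdE/is_pdMr/(is_pd_sqr _ (warpingR W) Uy2).
Qed.

Lemma pdL_warpedLR i j p : pd (l i) (fun z => G z (l j) (r p)) y = 0.
Proof.
have [oU1 _ _] := metricL W.
rewrite pd_joinL (open_eq_pd _ oU1 Uy1 (fun z Uz => warpedLR W j p Uz Uy2)).
exact/is_pdE/is_pd_cst.
Qed.

Lemma pdR_warpedLR q j p : pd (r q) (fun z => G z (l j) (r p)) y = 0.
Proof.
have [oU2 _ _] := metricR W.
rewrite pd_joinR (open_eq_pd _ oU2 Uy2 (fun z Uz => warpedLR W j p Uy1 Uz)).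
exact/is_pdE/is_pd_cst.
Qed.

Lemma christoffel_warpedLLL k i j :
  christoffel G (l k) (l i) (l j) y = christoffel G1 k i j y1.
Proof.
rewrite /christoffel (sum_split sp) [X in _ + X]big1 ?addr0 => [|s _]; last first.
  by rewrite (warpedVLR W) ?mul0r.
congr (_ * _); apply: eq_bigr => s _; rewrite (warpedVLL W) // !pdL_warpedLL.
rewrite -mulrDr -mulrBr mulrACA mulVf ?mul1r //.
by rewrite expf_neq0 // gt_eqF // (warpingR W).2.
Qed.

End Christoffel.

Section ChristoffelMixed.
Context {n m1 m2 : nat} {sp : coord_split n m1 m2}.
Context {U1 : set 'rV[R]_m1} {U2 : set 'rV[R]_m2}.
Context {G1 : 'rV[R]_m1 -> 'M[R]_m1} {G2 : 'rV[R]_m2 -> 'M[R]_m2}.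
Context {al : 'rV[R]_m2 -> R} {be : 'rV[R]_m1 -> R} {G : 'rV[R]_n -> 'M[R]_n}.
Context (W : warped sp U1 U2 G1 G2 al be G).
Context {y1 : 'rV[R]_m1} {y2 : 'rV[R]_m2} (Uy1 : U1 y1) (Uy2 : U2 y2).
Local Notation y := (join sp y1 y2).
Local Notation l := (inL sp).
Local Notation r := (inR sp).

Let pdL_warpedRL i p j : pd (l i) (fun z => G z (r p) (l j)) y = 0.
Proof. exact: (pdR_warpedLR (warped_flip W) Uy2 Uy1). Qed.

Let al_neq0 : al y2 != 0.
Proof. by rewrite gt_eqF // (warpingR W).2. Qed.

Let be_neq0 : be y1 != 0.
Proof. by rewrite gt_eqF // (warpingL W).2. Qed.

(** Only the derivative of [al ^+ 2] along F survives. The result is written as a function on F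
    times a function on B, ready to be differentiated along F with the second factor constant. *)
Lemma christoffel_warpedRLL p i j :
  christoffel G (r p) (l i) (l j) y
  = al y2 ^+ 2 * gradient G2 (log al) p y2 * - (be y1 ^- 2 * G1 y1 i j).
Proof.
rewrite /christoffel (sum_split sp) big1 ?add0r => [|s _]; last first.
  by rewrite (warpedVRL W) ?mul0r.
rewrite /gradient [al y2 ^+ 2 * _]mulr_sumr mulr_suml mulr_sumr.
apply: eq_bigr => s _; rewrite (warpedVRR W) //.
rewrite !(pdL_warpedLR W) // (pdR_warpedLL W) //.
by field.
Qed.

Lemma christoffel_warpedLLR k i p :
  christoffel G (l k) (l i) (r p) y = (k == i)%:R * pd p (log al) y2.
Proof.
rewrite /christoffel (sum_split sp) [X in _ + X]big1 ?addr0 => [|s _]; last first.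
  by rewrite (warpedVLR W) ?mul0r.
rewrite -(sum_invmx_l k i (metricL W) Uy1) mulr_suml mulr_sumr.
apply: eq_bigr => s _; rewrite (warpedVLL W) //.
rewrite pdL_warpedRL (pdR_warpedLL W) // (pdL_warpedLR W) //.
by field.
Qed.

Lemma christoffel_warpedLRL k p i :
  christoffel G (l k) (r p) (l i) y = (k == i)%:R * pd p (log al) y2.
Proof.
rewrite /christoffel (sum_split sp) [X in _ + X]big1 ?addr0 => [|s _]; last first.
  by rewrite (warpedVLR W) ?mul0r.
rewrite -(sum_invmx_l k i (metricL W) Uy1) mulr_suml mulr_sumr.
apply: eq_bigr => s _; rewrite (warpedVLL W) //.
rewrite pdL_warpedRL (pdR_warpedLL W) // pdL_warpedRL.
by field.
Qed.

End ChristoffelMixed.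

Section WarpedChristoffel.
Context {n m1 m2 : nat} {sp : coord_split n m1 m2}.
Context {U1 : set 'rV[R]_m1} {U2 : set 'rV[R]_m2}.
Context {G1 : 'rV[R]_m1 -> 'M[R]_m1} {G2 : 'rV[R]_m2 -> 'M[R]_m2}.
Context {al : 'rV[R]_m2 -> R} {be : 'rV[R]_m1 -> R} {G : 'rV[R]_n -> 'M[R]_n}.
Context (W : warped sp U1 U2 G1 G2 al be G).
Local Notation l := (inL sp).
Local Notation r := (inR sp).

(** This and the next three are the earlier symbols for the flipped splitting; since [flip] merely
    exchanges fields, the two forms of each statement agree by conversion. *)
Definition christoffel_warpedRRR y1 y2 (Uy1 : U1 y1) (Uy2 : U2 y2) k p q :
    christoffel G (r k) (r p) (r q) (join sp y1 y2) = christoffel G2 k p q y2 :=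
  christoffel_warpedLLL (warped_flip W) Uy2 Uy1 k p q.

Definition christoffel_warpedLRR y1 y2 (Uy1 : U1 y1) (Uy2 : U2 y2) i p q :
    christoffel G (l i) (r p) (r q) (join sp y1 y2)
    = be y1 ^+ 2 * gradient G1 (log be) i y1 * - (al y2 ^- 2 * G2 y2 p q) :=
  christoffel_warpedRLL (warped_flip W) Uy2 Uy1 i p q.

Definition christoffel_warpedRRL y1 y2 (Uy1 : U1 y1) (Uy2 : U2 y2) k p i :
    christoffel G (r k) (r p) (l i) (join sp y1 y2)
    = (k == p)%:R * pd i (log be) y1 :=
  christoffel_warpedLLR (warped_flip W) Uy2 Uy1 k p i.

Definition christoffel_warpedRLR y1 y2 (Uy1 : U1 y1) (Uy2 : U2 y2) k i p :
    christoffel G (r k) (l i) (r p) (join sp y1 y2)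
    = (k == p)%:R * pd i (log be) y1 :=
  christoffel_warpedLRL (warped_flip W) Uy2 Uy1 k i p.

End WarpedChristoffel.

Lemma sum_deltal (m : nat) (k : 'I_m) (f : 'I_m -> R) :
  \sum_s (k == s)%:R * f s = f k.
Proof.
rewrite (bigD1 k) //= big1 ?addr0 => [|s sk]; first by rewrite eqxx mul1r.
by rewrite eq_sym (negPf sk) mul0r.
Qed.

(** * Ricci tensor of the warped metric and Hessian of a split function *)

Section WarpedRicci.
Context {n m1 m2 : nat} {sp : coord_split n m1 m2}.
Context {U1 : set 'rV[R]_m1} {U2 : set 'rV[R]_m2}.
Context {G1 : 'rV[R]_m1 -> 'M[R]_m1} {G2 : 'rV[R]_m2 -> 'M[R]_m2}.
Context {al : 'rV[R]_m2 -> R} {be : 'rV[R]_m1 -> R} {G : 'rV[R]_n -> 'M[R]_n}.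
Context (W : warped sp U1 U2 G1 G2 al be G).
Context {y1 : 'rV[R]_m1} {y2 : 'rV[R]_m2} (Uy1 : U1 y1) (Uy2 : U2 y2).
Local Notation y := (join sp y1 y2).
Local Notation l := (inL sp).
Local Notation r := (inR sp).
Local Notation a := (log al).
Local Notation b := (log be).

Let oU1 : open U1. Proof. by case: (metricL W). Qed.
Let oU2 : open U2. Proof. by case: (metricR W). Qed.

Let pdL i f h : (forall z, U1 z -> f (join sp z y2) = h z) ->
  pd (l i) f y = pd i h y1.
Proof. by move=> fh; rewrite pd_joinL (open_eq_pd _ oU1 Uy1 fh). Qed.

Let pdR p f h : (forall z, U2 z -> f (join sp y1 z) = h z) ->
  pd (r p) f y = pd p h y2.
Proof. by move=> fh; rewrite pd_joinR (open_eq_pd _ oU2 Uy2 fh). Qed.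

Let al_neq0 : al y2 != 0.
Proof. by rewrite gt_eqF // (warpingR W).2. Qed.

Let be_neq0 : be y1 != 0.
Proof. by rewrite gt_eqF // (warpingL W).2. Qed.

Let is_pd2_a p q : is_pd p (pd q a) y2 (pd p (pd q a) y2).
Proof. exact: is_pd2_log oU2 (warpingR W) Uy2. Qed.

Let c := al y2 ^+ 2 * be y1 ^- 2.

(** Summation indices in B reproduce the curvature of B. Those in F give the correction of the Gauss
    equation for the slices of B, which are totally umbilic. *)
Lemma riemann_warpedLL i j k :
  riemann_tensor G (l i) (l k) (l i) (l j) y
  = riemann_tensor G1 i k i j y1
    - c * gradient_dot G2 a a y2 * (G1 y1 j k - (i == j)%:R * G1 y1 i k).
Proof.
rewrite /riemann_tensor (sum_split sp).
rewrite (pdL i (h := christoffel G1 i j k)) => [|z Uz]; last first.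
  exact: (christoffel_warpedLLL W).
rewrite (pdL j (h := christoffel G1 i i k)) => [|z Uz]; last first.
  exact: (christoffel_warpedLLL W).
rewrite -!addrA; do 3 congr (_ + _).
  by apply: eq_bigr => m _; rewrite !(christoffel_warpedLLL W).
rewrite /gradient_dot mulr_sumr mulr_suml -sumrN; apply: eq_bigr => s _.
rewrite !(christoffel_warpedLLR W) // !(christoffel_warpedRLL W) // eqxx mul1r /c.
by field.
Qed.

(** The last bracket is arranged so that its sum over [p] is |grad a|^2 plus the divergence of grad
    a, to which [gradient_divergence] applies. *)
Lemma riemann_warpedRL p j k :
  riemann_tensor G (r p) (l k) (r p) (l j) y
  = - hessian_mx G1 b y1 j k - pd j b y1 * pd k b y1
    - c * G1 y1 j k * (gradient G2 a p y2 * pd p a y2 + pd p (gradient G2 a p) y2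
        + \sum_s christoffel G2 p p s y2 * gradient G2 a s y2).
Proof.
rewrite /riemann_tensor (sum_split sp).
have -> : pd (r p) (christoffel G (r p) (l j) (l k)) y
    = (al y2 ^+ 2 * pd p (gradient G2 a p) y2
       + 2 * al y2 ^+ 2 * pd p a y2 * gradient G2 a p y2)
      * - (be y1 ^- 2 * G1 y1 j k).
  rewrite (pdR p (h := fun z => al z ^+ 2 * gradient G2 a p z
                       * - (be y1 ^- 2 * G1 y1 j k))) => [|z Uz]; last first.
    exact: (christoffel_warpedRLL W).
  apply/is_pdE/is_pdMr/is_pdM; first exact: is_pd_sqr (warpingR W) Uy2.
  by apply: is_pdP; case: (is_pd_gradient p (metricR W) Uy2 (is_pd2_a p)).
rewrite (pdL j (h := pd k b)) => [|z Uz]; last first.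
  by rewrite (christoffel_warpedRRL W) // eqxx mul1r.
have -> : \sum_m (christoffel G (r p) (r p) (l m) y * christoffel G (l m) (l j) (l k) y
    - christoffel G (r p) (l j) (l m) y * christoffel G (l m) (r p) (l k) y)
    = \sum_m christoffel G1 m j k y1 * pd m b y1
      + c * gradient G2 a p y2 * pd p a y2 * G1 y1 j k.
  (* The isolated product is expanded against a Kronecker delta so that both sides can be compared
     term by term. *)
  rewrite -[in RHS](sum_deltal k (fun m => G1 y1 j m)) mulr_sumr -big_split /=.
  apply: eq_bigr => m _.
  rewrite (christoffel_warpedRRL W) // (christoffel_warpedLLL W) //.
  rewrite (christoffel_warpedRLL W) // (christoffel_warpedLRL W) // eqxx mul1r /c.
  by rewrite (eq_sym m k); field.
have -> : \sum_s (christoffel G (r p) (r p) (r s) y * christoffel G (r s) (l j) (l k) y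
    - christoffel G (r p) (l j) (r s) y * christoffel G (r s) (r p) (l k) y)
    = - c * G1 y1 j k * (\sum_s christoffel G2 p p s y2 * gradient G2 a s y2)
      - pd j b y1 * pd k b y1.
  rewrite -(sum_deltal p (fun s => pd j b y1 * pd k b y1)) mulr_sumr -sumrB.
  apply: eq_bigr => s _.
  rewrite (christoffel_warpedRRR W) // (christoffel_warpedRLL W) //.
  rewrite (christoffel_warpedRLR W) // (christoffel_warpedRRL W) // /c eq_sym.
  move: (christoffel G2 _ _ _ _) (gradient _ _ _ _) (pd j b y1) (pd k b y1).
  move: (G1 y1 j k) (al y2) (be y1) be_neq0 => g u v v0 x1 x2 x3 x4.
  by case: (s == p) => /=; field.
rewrite mxE /c; move: (\sum_s _ * gradient _ _ _ _) (pd p (gradient _ _ _) y2).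
move: (gradient _ _ _ _) (pd j (pd k b) y1) (pd j b y1) (pd k b y1) (pd p a y2).
move: (\sum_s _ * _) (G1 y1 j k) (al y2) (be y1) be_neq0 => *.
by field.
Qed.

(** The coefficient [m1] of |grad a|^2 is the sum of m1 - 1 from the trace over B and 1 from the
    trace over F. *)
Lemma ricci_warpedLL j k :
  ricci_mx G y (l j) (l k) = ricci_mx G1 y1 j k
    - m2%:R * (hessian_mx G1 b y1 j k + pd j b y1 * pd k b y1)
    - c * (laplacian G2 a y2 + m1%:R * gradient_dot G2 a a y2) * G1 y1 j k.
Proof.
rewrite mxE [ricci_mx G1 _ _ _]mxE (sum_split sp).
under eq_bigr do rewrite riemann_warpedLL.
under [X in _ + X]eq_bigr do rewrite riemann_warpedRL.
rewrite !sumrB -!mulr_sumr !sumrB !big_split /= !sumr_const !card_ord.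
rewrite -(gradient_divergence (metricR W) Uy2 is_pd2_a).
have -> : \sum_i (i == j)%:R * G1 y1 i k = G1 y1 j k.
  by under eq_bigr do rewrite eq_sym; rewrite sum_deltal.
rewrite -[\sum_p _ * pd p _ _]/(gradient_dot G2 a a y2).
move: (\sum_p pd p _ _) (\sum_p \sum_s _) (gradient_dot _ _ _ _) c => x1 x2 x3 x4.
move: (hessian_mx _ _ _ _ _) (pd j b y1) (pd k b y1) (G1 y1 j k) => x5 x6 x7 x8.
by ring.
Qed.

(** Every Christoffel symbol that gets differentiated here is constant in the direction of
    differentiation, so only products remain. The trace over B contributes m1 - 1 and the trace over
    F contributes m2 - 1. *)
Lemma ricci_warpedLR j q :
  ricci_mx G y (l j) (r q) = (m1%:R + m2%:R - 2) * pd j b y1 * pd q a y2.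
Proof.
rewrite mxE (sum_split sp).
have L i : riemann_tensor G (l i) (r q) (l i) (l j) y
    = pd j b y1 * pd q a y2 - (j == i)%:R * (pd i b y1 * pd q a y2).
  rewrite /riemann_tensor (sum_split sp).
  rewrite (pdL i (h := fun=> (i == j)%:R * pd q a y2)) => [|z Uz]; last first.
    exact: (christoffel_warpedLLR W).
  rewrite (pdL j (h := fun=> (i == i)%:R * pd q a y2)) => [|z Uz]; last first.
    exact: (christoffel_warpedLLR W).
  rewrite !(is_pdE (is_pd_cst _ _ _)) subrr add0r.
  have -> : \sum_m (christoffel G (l i) (l i) (l m) y * christoffel G (l m) (l j) (r q) y
      - christoffel G (l i) (l j) (l m) y * christoffel G (l m) (l i) (r q) y) = 0.
    rewrite sumrB.
    under eq_bigr do
      rewrite (christoffel_warpedLLL W) // (christoffel_warpedLLR W) // mulrCA eq_sym.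
    under [X in _ - X]eq_bigr do
      rewrite (christoffel_warpedLLL W) // (christoffel_warpedLLR W) // mulrCA eq_sym.
    by rewrite 2!sum_deltal (christoffel_sym _ _ _ (metricL W) Uy1) subrr.
  rewrite add0r sumrB.
  under eq_bigr do
    rewrite (christoffel_warpedLLR W) // (christoffel_warpedRLR W) //
      eqxx mul1r mulrCA eq_sym.
  under [X in _ - X]eq_bigr do
    rewrite (christoffel_warpedLLR W) // (christoffel_warpedRLR W) // mulrCA eq_sym.
  by congr (_ - _); rewrite sum_deltal ?(eq_sym i j); ring.
have r_ p : riemann_tensor G (r p) (r q) (r p) (l j) y
    = pd j b y1 * pd q a y2 - pd j b y1 * (G2 y2 q p * gradient G2 a p y2).
  rewrite /riemann_tensor (sum_split sp).
  rewrite (pdR p (h := fun=> (p == q)%:R * pd j b y1)) => [|z Uz]; last first.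
    exact: (christoffel_warpedRLR W).
  rewrite (pdL j (h := fun=> christoffel G2 p p q y2)) => [|z Uz]; last first.
    exact: (christoffel_warpedRRR W).
  rewrite !(is_pdE (is_pd_cst _ _ _)) subrr add0r.
  have -> : \sum_s (christoffel G (r p) (r p) (r s) y * christoffel G (r s) (l j) (r q) y
      - christoffel G (r p) (l j) (r s) y * christoffel G (r s) (r p) (r q) y) = 0.
    rewrite sumrB.
    under eq_bigr do
      rewrite (christoffel_warpedRRR W) // (christoffel_warpedRLR W) // mulrCA eq_sym.
    under [X in _ - X]eq_bigr do
      rewrite (christoffel_warpedRRR W) // (christoffel_warpedRLR W) // -mulrA.
    by rewrite 2!sum_deltal mulrC subrr.
  rewrite addr0 sumrB; congr (_ - _).
    under eq_bigr do
      rewrite (christoffel_warpedRRL W) // (christoffel_warpedLLR W) //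
        eqxx mul1r mulrCA eq_sym.
    by rewrite sum_deltal.
  (* Writing d_j b as the lowered gradient of b turns both sides into sums over B-indices. *)
  rewrite -(sum_metric_gradient b j (metricL W) Uy1) mulr_suml.
  apply: eq_bigr => m _.
  rewrite (christoffel_warpedRLL W) // (christoffel_warpedLRR W) //.
  have [_ pG2 _] := metricR W; have [sG _] := pG2 _ Uy2.
  rewrite -[in G2 y2 p q]sG mxE.
  by field; rewrite al_neq0 be_neq0.
under eq_bigr do rewrite L.
under [X in _ + X]eq_bigr do rewrite r_.
rewrite !sumrB sum_deltal !sumr_const !card_ord -mulr_sumr.
by rewrite (sum_metric_gradient _ _ (metricR W) Uy2); ring.
Qed.

Section Hessian.
Variables (f1 : 'rV[R]_m1 -> R) (f2 : 'rV[R]_m2 -> R) (f : 'rV[R]_n -> R).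
Hypothesis df2 : forall p y2, U2 y2 -> is_pd p f2 y2 (pd p f2 y2).
Hypothesis df1 : forall i y1, U1 y1 -> is_pd i f1 y1 (pd i f1 y1).
Hypothesis fE : forall y1 y2, U1 y1 -> U2 y2 -> f (join sp y1 y2) = f1 y1 + f2 y2.

Lemma pdL_split i y1' : U1 y1' -> pd (l i) f (join sp y1' y2) = pd i f1 y1'.
Proof.
move=> Uy; rewrite pd_joinL (open_eq_pd _ oU1 Uy (fun z Uz => fE Uz Uy2)).
by rewrite (is_pdE (is_pdD (df1 i Uy) (is_pd_cst _ _ _))) addr0.
Qed.

Lemma pdR_split p y1' : U1 y1' -> pd (r p) f (join sp y1' y2) = pd p f2 y2.
Proof.
move=> Uy; rewrite pd_joinR (open_eq_pd _ oU2 Uy2 (fun z Uz => fE Uy Uz)).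
by rewrite (is_pdE (is_pdD (is_pd_cst _ _ _) (df2 p Uy2))) add0r.
Qed.

Lemma hessian_warpedLL j k :
  hessian_mx G f y (l j) (l k) = hessian_mx G1 f1 y1 j k
    + c * gradient_dot G2 a f2 y2 * G1 y1 j k.
Proof.
rewrite !mxE (sum_split sp) (pdL j (h := pd k f1)) => [|z Uz]; last first.
  exact: pdL_split.
rewrite opprD addrA; congr (_ - _ + _); last first.
  rewrite /gradient_dot mulr_sumr mulr_suml -sumrN; apply: eq_bigr => s _.
  by rewrite (christoffel_warpedRLL W) // pdR_split // /c; field.
apply: eq_bigr => s _.
by rewrite (christoffel_warpedLLL W) // pdL_split.
Qed.

(** The mixed second derivative of a sum f1 + f2 vanishes; what is left comes from the two mixed
    Christoffel symbols. *)
Lemma hessian_warpedLR j q :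
  hessian_mx G f y (l j) (r q) = - (pd q a y2 * pd j f1 y1 + pd j b y1 * pd q f2 y2).
Proof.
rewrite mxE (sum_split sp) (pdL j (h := fun=> pd q f2 y2)) => [|z Uz]; last first.
  exact: pdR_split.
rewrite (is_pdE (is_pd_cst _ _ _)) sub0r; congr (- (_ + _)).
  under eq_bigr do rewrite (christoffel_warpedLLR W) // pdL_split // -mulrA eq_sym.
  by rewrite sum_deltal.
under eq_bigr do rewrite (christoffel_warpedRLR W) // pdR_split // -mulrA eq_sym.
by rewrite sum_deltal.
Qed.

End Hessian.

End WarpedRicci.

End DoublyWarpedCoordinates.

(** * Quadratic forms and the pointwise inequalities *)

Section QuadraticForms.
Context {R : realType}.

Definition directional n (f : 'rV[R]_n -> R) (X y : 'rV[R]_n) : R :=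
  \sum_i X ord0 i * pd i f y.

Lemma qformD n (A B : 'M[R]_n) X : qform (A + B) X = qform A X + qform B X.
Proof. by rewrite /qform mulmxDr mulmxDl mxE. Qed.

Lemma qformZ n c (A : 'M[R]_n) X : qform (c *: A) X = c * qform A X.
Proof. by rewrite /qform -scalemxAr -scalemxAl mxE. Qed.

Lemma qform_scale n c (A : 'M[R]_n) X : qform A (c *: X) = c ^+ 2 * qform A X.
Proof.
by rewrite /qform -!scalemxAl linearZ /= -scalemxAr scalerA mxE expr2.
Qed.

Lemma directional_scale n c f (X y : 'rV[R]_n) :
  directional f (c *: X) y = c * directional f X y.
Proof.
by rewrite /directional mulr_sumr; apply: eq_bigr => i _; rewrite mxE mulrA.
Qed.

Lemma bilinear_rank1 m n (p : 'I_m -> R) (q : 'I_n -> R) (X : 'rV[R]_m) (Y : 'rV[R]_n) :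
  \sum_i \sum_j X ord0 i * (p i * q j) * Y ord0 j
  = (\sum_i X ord0 i * p i) * (\sum_j Y ord0 j * q j).
Proof.
rewrite mulr_suml; apply: eq_bigr => i _; rewrite mulr_sumr; apply: eq_bigr => j _.
by ring.
Qed.

Definition differential_mx n (f h : 'rV[R]_n -> R) (y : 'rV[R]_n) : 'M[R]_n :=
  \matrix_(i, j) (pd i f y * pd j h y).

Lemma qform_differential n f h (y X : 'rV[R]_n) :
  qform (differential_mx f h y) X = directional f X y * directional h X y.
Proof.
rewrite qformE /directional -bilinear_rank1; apply: eq_bigr => i _.
by apply: eq_bigr => j _; rewrite mxE.
Qed.

Lemma gradient_dot_frame n G (P : 'M[R]_n) f h y : P *m G y *m P^T = 1%:M ->
  gradient_dot G f h y
  = \sum_k directional f (row k P) y * directional h (row k P) y.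
Proof.
move=> /trace_frame E.
transitivity (\sum_k qform (differential_mx h f y) (row k P)); last first.
  by apply: eq_bigr => k _; rewrite qform_differential mulrC.
rewrite -E; apply: eq_bigr => s _; rewrite /gradient mulr_suml.
by apply: eq_bigr => t _; rewrite mxE mulrAC mulrA.
Qed.

(* An upper bound for the Hessian by a sufficiently negative multiple of the
   squared gradients makes the Laplacian term of the other factor's Ricci
   curvature nonpositive. *)
Lemma weighted_laplacian_le0 n (G : 'rV[R]_n -> 'M[R]_n) (a Psi : 'rV[R]_n -> R) y
    (r eta : R) : posdef (G y) -> 0 < r -> eta <= - (r ^+ 2 + r) ->
  (forall X, qform (G y) X = 1 -> r * qform (hessian_mx G a y) X
     <= eta * directional Psi X y ^+ 2 + eta * directional a X y ^+ 2) ->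
  laplacian G a y + r * gradient_dot G a a y - gradient_dot G a Psi y <= 0.
Proof.
move=> pG r0 etaE aH; have [P PE] := orthonormal_frame pG.
rewrite /laplacian (trace_frame _ PE) !(gradient_dot_frame _ _ PE).
rewrite mulr_sumr -big_split -sumrB /=; apply: sumr_le0 => k _.
have qk : qform (G y) (row k P) = 1.
  transitivity ((1%:M : 'M[R]_n) k k); last by rewrite mxE eqxx.
  rewrite -PE /qform -row_mul !mxE; apply: eq_bigr => j _.
  by rewrite !mxE.
have := aH _ qk; rewrite -(ler_pM2l r0 _ 0) mulr0.
move: (qform _ _) (directional Psi _ _) (directional a _ _) => h p q.
set u := p ^+ 2 + q ^+ 2; move=> hE.
have u0 : 0 <= u by rewrite addr_ge0 ?sqr_ge0.
(* After multiplication by [r] each frame vector has to satisfy r h + r^2 q^2 - r p q <= 0. Here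
   [r ^+ 2] in the bound on [eta] pays for r^2 q^2, and [r] pays for the cross term by Young's
   inequality. *)
have : eta * u <= - (r ^+ 2 + r) * u by rewrite ler_wpM2r.
have : 0 <= r * (p + q) ^+ 2 by rewrite mulr_ge0 ?sqr_ge0 ?ltW.
have : 0 <= r * p ^+ 2 by rewrite mulr_ge0 ?sqr_ge0 ?ltW.
have : 0 <= r * q ^+ 2 by rewrite mulr_ge0 ?sqr_ge0 ?ltW.
have : 0 <= r ^+ 2 * p ^+ 2 by rewrite mulr_ge0 ?sqr_ge0.
by move: hE; rewrite /u; lra.
Qed.

(** Both sides are homogeneous of degree two, so the bound passes from unit vectors to all nonzero
    ones by normalization. *)
Lemma hessian_bound_scale n (G : 'rV[R]_n -> 'M[R]_n) (b Phi : 'rV[R]_n -> R) y r eta :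
  posdef (G y) ->
  (forall X, qform (G y) X = 1 -> r * qform (hessian_mx G b y) X
     <= eta * directional Phi X y ^+ 2 + eta * directional b X y ^+ 2) ->
  forall X, r * qform (hessian_mx G b y) X
     <= eta * (directional Phi X y ^+ 2 + directional b X y ^+ 2).
Proof.
move=> pG bH X; have [->|X0] := eqVneq X 0.
  rewrite -(scale0r 0) qform_scale !directional_scale.
  by rewrite !mul0r expr0n /= !mul0r !mulr0 addr0 mulr0.
have q0 : 0 < qform (G y) X by exact: pG.2.
set t := (Num.sqrt (qform (G y) X))^-1.
have t2 : t ^+ 2 = (qform (G y) X)^-1 by rewrite exprVn sqr_sqrtr // ltW.
have := bH (t *: X); rewrite !qform_scale !directional_scale !exprMn t2.
rewrite mulVf ?gt_eqF // => /(_ erefl).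
by rewrite mulrCA ![eta * (_^-1 * _)]mulrCA -mulrDr ler_pM2l ?invr_gt0 // mulrDr.
Qed.

(** The left side collects, with opposite sign, what the estimate of Ric^N_chi leaves to be
    absorbed: the squares from the diagonal blocks, twice the mixed block of Ric + nabla^2 chi, and
    s (d chi)^2. It is used with k_i = n_i - R_i and s = 1/(N - n_1 - n_2). On the right, m1 + m2
    comes once from the squares and once from the mixed Ricci term, whose remaining part 4 (Xb)(Ua)
    gives 2; the products with X Phi and U Psi give 1 each, hence the summand 4. The factor 4 beside
    [s] is Cauchy-Schwarz for a sum of four terms. *)
Lemma mixed_terms_bound (m1 m2 k1 k2 s xb xPhi ua uPsi S : R) :
  0 <= m1 -> 0 <= m2 -> 0 <= s ->
  S = xPhi ^+ 2 + xb ^+ 2 + (uPsi ^+ 2 + ua ^+ 2) ->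
  m2 * xb ^+ 2 + m1 * ua ^+ 2 - 2 * (m1 + m2 - 2) * (xb * ua)
  + 2 * (ua * (k2 * xb + xPhi)) + 2 * (xb * (k1 * ua + uPsi))
  + s * (k2 * xb + xPhi + (k1 * ua + uPsi)) ^+ 2
  <= (2 * (m1 + m2) + 4 + `|k1| + `|k2| + 4 * s * (k1 ^+ 2 + k2 ^+ 2 + 2)) * S.
Proof.
move=> m10 m20 s0 SE.
have xb0 := sqr_ge0 xb; have xP0 := sqr_ge0 xPhi.
have ua0 := sqr_ge0 ua; have uP0 := sqr_ge0 uPsi.
have S0 : 0 <= S by lra.
have young (k p q : R) : p ^+ 2 + q ^+ 2 <= S -> 2 * (k * (p * q)) <= `|k| * S.
  move=> pq; have pqS : `|2 * (p * q)| <= S.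
    have := sqr_ge0 (p + q); have := sqr_ge0 (p - q).
    by rewrite ler_norml => *; apply/andP; split; lra.
  rewrite mulrCA; apply: le_trans (ler_norm _) _.
  by rewrite normrM ler_wpM2l.
have h1 := young (- (m1 + m2)) xb ua; have h2 := young k2 xb ua.
have h3 := young 1 ua xPhi; have h4 := young k1 xb ua; have h5 := young 1 xb uPsi.
have h6 := young 2 xb ua.
have sq : (k2 * xb + xPhi + (k1 * ua + uPsi)) ^+ 2
    <= 4 * (k1 ^+ 2 + k2 ^+ 2 + 2) * S.
  have q2 := mulr_ge0 (sqr_ge0 k2) S0; have q1 := mulr_ge0 (sqr_ge0 k1) S0.
  have k2b : (k2 * xb) ^+ 2 <= k2 ^+ 2 * S.
    by rewrite exprMn ler_wpM2l ?sqr_ge0 //; lra.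
  have k1a : (k1 * ua) ^+ 2 <= k1 ^+ 2 * S.
    by rewrite exprMn ler_wpM2l ?sqr_ge0 //; lra.
  have : (k2 * xb + xPhi + (k1 * ua + uPsi)) ^+ 2
    <= 4 * ((k2 * xb) ^+ 2 + xPhi ^+ 2 + ((k1 * ua) ^+ 2 + uPsi ^+ 2)).
    move: (k2 * xb) (k1 * ua) => p q.
    have := sqr_ge0 (p - xPhi); have := sqr_ge0 (p - q); have := sqr_ge0 (p - uPsi).
    have := sqr_ge0 (xPhi - q); have := sqr_ge0 (xPhi - uPsi); have := sqr_ge0 (q - uPsi).
    by lra.
  by move=> /le_trans; apply; lra.
have := ler_wpM2l s0 sq.
have m2S : m2 * xb ^+ 2 <= m2 * S by rewrite ler_wpM2l //; lra.
have m1S : m1 * ua ^+ 2 <= m1 * S by rewrite ler_wpM2l //; lra.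
have e1 : xb ^+ 2 + ua ^+ 2 <= S by lra.
have e2 : ua ^+ 2 + xPhi ^+ 2 <= S by lra.
have e3 : xb ^+ 2 + uPsi ^+ 2 <= S by lra.
move: (h1 e1) (h2 e1) (h3 e2) (h4 e1) (h5 e3) (h6 e1).
rewrite normrN (ger0_norm (addr_ge0 m10 m20)) normr1 normr_nat.
by lra.
Qed.

End QuadraticForms.

Lemma hessian_mx_linear (R : realType) n (U : set 'rV[R]_n) G c f g y :
  open U -> U y ->
  (forall i z, U z -> is_pd i f z (pd i f z)) ->
  (forall i z, U z -> is_pd i g z (pd i g z)) ->
  (forall i j, is_pd i (pd j f) y (pd i (pd j f) y)) ->
  (forall i j, is_pd i (pd j g) y (pd i (pd j g) y)) ->
  hessian_mx G (fun z => c * f z + g z) y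
  = c *: hessian_mx G f y + hessian_mx G g y.
Proof.
move=> oU Uy df dg ddf ddg.
have pdE j z : U z -> pd j (fun z => c * f z + g z) z = c * pd j f z + pd j g z.
  by move=> Uz; apply/is_pdE/is_pdD; [apply: is_pdMl; exact: df|exact: dg].
apply/matrixP => i j; rewrite !mxE.
rewrite (open_eq_pd _ oU Uy (pdE j)) (is_pdE (is_pdD (is_pdMl c (ddf i j)) (ddg i j))).
under eq_bigr do rewrite pdE // mulrDr mulrCA.
rewrite big_split /= -mulr_sumr mulrBr opprD.
exact: addrACA.
Qed.

(** * The curvature estimate in a product chart *)

Section CurvatureEstimate.
Context {R : realType}.

(* [f] is the potential chi of [warped_weight], regrouped by factor. *)
Record warped_potential n m1 m2 (sp : @coord_split R n m1 m2) U1 U2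
    (al : 'rV[R]_m2 -> R) (be : 'rV[R]_m1 -> R) (R1 R2 : R) Phi Psi
    (f : 'rV[R]_n -> R) : Prop := WarpedPotential {
  potential_smoothL : smooth_on U1 Phi;
  potential_smoothR : smooth_on U2 Psi;
  potentialE : forall y1 y2, U1 y1 -> U2 y2 -> f (join sp y1 y2)
    = ((m2%:R - R2) * log be y1 + Phi y1) + ((m1%:R - R1) * log al y2 + Psi y2)
}.

Lemma warped_potential_flip n m1 m2 (sp : @coord_split R n m1 m2) U1 U2 al be R1 R2
    Phi Psi f : warped_potential sp U1 U2 al be R1 R2 Phi Psi f ->
  warped_potential (flip sp) U2 U1 be al R2 R1 Psi Phi f.
Proof.
case=> sPhi sPsi fE; split=> // y1 y2 Uy1 Uy2.
by rewrite /= fE // addrC.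
Qed.

Lemma qform_split n m1 m2 (sp : @coord_split R n m1 m2) (A : 'M[R]_n) (v : 'rV[R]_n)
    (X : 'rV[R]_m1) (Y : 'rV[R]_m2) :
  (forall i, v ord0 (inL sp i) = X ord0 i) ->
  (forall p, v ord0 (inR sp p) = Y ord0 p) ->
  qform A v = qform (mxsub (inL sp) (inL sp) A) X
    + qform (mxsub (inR sp) (inR sp) A) Y
    + (\sum_(i < m1) \sum_(p < m2)
         X ord0 i * A (inL sp i) (inR sp p) * Y ord0 p
       + \sum_(p < m2) \sum_(i < m1)
         Y ord0 p * A (inR sp p) (inL sp i) * X ord0 i).
Proof.
move=> vL vR; rewrite !qformE (sum_split sp).
under eq_bigr do rewrite (sum_split sp).
under [X in _ + X]eq_bigr do rewrite (sum_split sp).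
rewrite !big_split /= [X in _ + X]addrC addrACA.
congr (_ + _ + (_ + _)); apply: eq_bigr => i _; apply: eq_bigr => j _;
  by rewrite ?vL ?vR ?mxE.
Qed.

Section Blocks.
Context {n m1 m2 : nat} {sp : @coord_split R n m1 m2}.
Context {U1 : set 'rV[R]_m1} {U2 : set 'rV[R]_m2}.
Context {G1 : 'rV[R]_m1 -> 'M[R]_m1} {G2 : 'rV[R]_m2 -> 'M[R]_m2}.
Context {al : 'rV[R]_m2 -> R} {be : 'rV[R]_m1 -> R} {G : 'rV[R]_n -> 'M[R]_n}.
Context (W : warped sp U1 U2 G1 G2 al be G).
Context {R1 R2 : R} {Phi : 'rV[R]_m1 -> R} {Psi : 'rV[R]_m2 -> R}.
Context {f : 'rV[R]_n -> R} (P : warped_potential sp U1 U2 al be R1 R2 Phi Psi f).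
Context {y1 : 'rV[R]_m1} {y2 : 'rV[R]_m2} (Uy1 : U1 y1) (Uy2 : U2 y2).
Local Notation y := (join sp y1 y2).
Local Notation a := (log al).
Local Notation b := (log be).

Let f1 z := (m2%:R - R2) * b z + Phi z.
Let f2 z := (m1%:R - R1) * a z + Psi z.

Let df1 i z : U1 z -> is_pd i f1 z ((m2%:R - R2) * pd i b z + pd i Phi z).
Proof.
move=> Uz; apply: is_pdD; last exact: smooth_is_pd (potential_smoothL P) Uz.
exact/is_pdMl/(is_pd_log _ (warpingL W) Uz).
Qed.

Let df2 p z : U2 z -> is_pd p f2 z ((m1%:R - R1) * pd p a z + pd p Psi z).
Proof.
move=> Uz; apply: is_pdD; last exact: smooth_is_pd (potential_smoothR P) Uz.
exact/is_pdMl/(is_pd_log _ (warpingR W) Uz).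
Qed.

Let pdf1 i z : U1 z -> is_pd i f1 z (pd i f1 z).
Proof. by move=> Uz; rewrite (is_pdE (df1 i Uz)); exact: df1. Qed.

Let pdf2 p z : U2 z -> is_pd p f2 z (pd p f2 z).
Proof. by move=> Uz; rewrite (is_pdE (df2 p Uz)); exact: df2. Qed.

Lemma directional_potentialL X :
  directional f1 X y1 = (m2%:R - R2) * directional b X y1 + directional Phi X y1.
Proof.
rewrite /directional mulr_sumr -big_split /=; apply: eq_bigr => i _.
by rewrite (is_pdE (df1 i Uy1)) mulrDr mulrCA.
Qed.

Lemma directional_potentialR Y :
  directional f2 Y y2 = (m1%:R - R1) * directional a Y y2 + directional Psi Y y2.
Proof.
rewrite /directional mulr_sumr -big_split /=; apply: eq_bigr => i _.
by rewrite (is_pdE (df2 i Uy2)) mulrDr mulrCA.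
Qed.

Lemma directional_potential (v : 'rV[R]_n) (X : 'rV[R]_m1) (Y : 'rV[R]_m2) :
  (forall i, v ord0 (inL sp i) = X ord0 i) ->
  (forall p, v ord0 (inR sp p) = Y ord0 p) ->
  directional f v y = ((m2%:R - R2) * directional b X y1 + directional Phi X y1)
    + ((m1%:R - R1) * directional a Y y2 + directional Psi Y y2).
Proof.
move=> vL vR; rewrite -directional_potentialL -directional_potentialR.
rewrite /directional (sum_split sp); congr (_ + _); apply: eq_bigr => i _.
  by rewrite vL (pdL_split W Uy2 pdf1 (potentialE P)).
by rewrite vR (pdR_split W Uy2 pdf2 (potentialE P)).
Qed.

(** Here the dimensions give way to the weights: - m2 + (m2 - R2) = - R2 in front of the Hessian of
    b, and m1 - (m1 - R1) = R1 in front of |grad a|^2. *)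
Lemma qform_curvatureLL X :
  qform (mxsub (inL sp) (inL sp) (ricci_mx G y + hessian_mx G f y)) X
  = qform (ricci_mx G1 y1) X + qform (hessian_mx G1 Phi y1) X
    - R2 * qform (hessian_mx G1 b y1) X - m2%:R * directional b X y1 ^+ 2
    - al y2 ^+ 2 * be y1 ^- 2
      * (laplacian G2 a y2 + R1 * gradient_dot G2 a a y2 - gradient_dot G2 a Psi y2)
      * qform (G1 y1) X.
Proof.
have [oU1 _ _] := metricL W.
have hE : hessian_mx G1 f1 y1 = (m2%:R - R2) *: hessian_mx G1 b y1
    + hessian_mx G1 Phi y1.
  apply: (hessian_mx_linear _ _ oU1 Uy1) => [i z Uz|i z Uz|i j|i j].
  - exact: is_pd_log (warpingL W) Uz.
  - exact: smooth_is_pd (potential_smoothL P) Uz.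
  - exact: is_pd2_log (warpingL W) Uy1.
  - exact: smooth_is_pd2 (potential_smoothL P) Uy1.
have gE : gradient_dot G2 a f2 y2
    = (m1%:R - R1) * gradient_dot G2 a a y2 + gradient_dot G2 a Psi y2.
  rewrite /gradient_dot mulr_sumr -big_split /=; apply: eq_bigr => p _.
  by rewrite (is_pdE (df2 p Uy2)) mulrDr mulrCA.
set c := al y2 ^+ 2 * be y1 ^- 2.
have -> : mxsub (inL sp) (inL sp) (ricci_mx G y + hessian_mx G f y)
    = ricci_mx G1 y1 + hessian_mx G1 Phi y1 + (- R2) *: hessian_mx G1 b y1
      + (- m2%:R) *: differential_mx b b y1
      + (- (c * (laplacian G2 a y2 + R1 * gradient_dot G2 a a y2
                 - gradient_dot G2 a Psi y2))) *: G1 y1.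
  apply/matrixP => i j; rewrite [LHS]mxE [LHS]mxE.
  rewrite (ricci_warpedLL W Uy1 Uy2).
  rewrite (hessian_warpedLL W Uy1 Uy2 pdf2 pdf1 (potentialE P)).
  have addE (A B : 'M[R]_m1) : (A + B) i j = A i j + B i j by rewrite mxE.
  have scaleE k (A : 'M[R]_m1) : (k *: A) i j = k * A i j by rewrite mxE.
  rewrite hE gE -/c !addE !scaleE [differential_mx _ _ _ _ _]mxE.
  move: (ricci_mx _ _ _ _) (hessian_mx _ _ _ _ _) (hessian_mx _ _ _ _ _).
  by move: c (laplacian _ _ _) (gradient_dot _ _ _ _) (gradient_dot _ _ _ _)
    (pd i b y1) (pd j b y1) (G1 _ _ _) => *; ring.
rewrite !qformD !qformZ qform_differential.
by rewrite expr2 !mulNr.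
Qed.

Lemma bilinear_curvatureLR (X : 'rV[R]_m1) (Y : 'rV[R]_m2) :
  \sum_(i < m1) \sum_(p < m2) X ord0 i
    * (ricci_mx G y + hessian_mx G f y) (inL sp i) (inR sp p) * Y ord0 p
  = (m1%:R + m2%:R - 2) * (directional b X y1 * directional a Y y2)
    - (directional f1 X y1 * directional a Y y2
       + directional b X y1 * directional f2 Y y2).
Proof.
rewrite -!bilinear_rank1 mulr_sumr -big_split -sumrB; apply: eq_bigr => i _ /=.
rewrite mulr_sumr -big_split -sumrB; apply: eq_bigr => p _ /=.
have -> : (ricci_mx G y + hessian_mx G f y) (inL sp i) (inR sp p)
    = ricci_mx G y (inL sp i) (inR sp p) + hessian_mx G f y (inL sp i) (inR sp p).
  by rewrite mxE.
rewrite (ricci_warpedLR W Uy1 Uy2).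
rewrite (hessian_warpedLR W Uy1 Uy2 pdf2 pdf1 (potentialE P)).
move: (pd i b y1) (pd p a y2) (pd i _ y1) (pd p _ y2) (X _ _) (Y _ _) => *.
by ring.
Qed.

End Blocks.

(** The first two pairs of summands force the signs of the two Laplacian brackets; the rest is the
    constant of [mixed_terms_bound]. *)
Definition hessian_constant (m1 m2 : nat) (N R1 R2 : R) : R :=
  - (R1 ^+ 2 + R1 + (R2 ^+ 2 + R2)
     + (2 * (m1%:R + m2%:R) + 4 + `|m1%:R - R1| + `|m2%:R - R2|
        + 4 * (N - (m1 + m2)%:R)^-1
          * ((m1%:R - R1) ^+ 2 + (m2%:R - R2) ^+ 2 + 2))).

Section Estimate.
Context {n m1 m2 : nat} {sp : @coord_split R n m1 m2}.
Context {U1 : set 'rV[R]_m1} {U2 : set 'rV[R]_m2}.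
Context {G1 : 'rV[R]_m1 -> 'M[R]_m1} {G2 : 'rV[R]_m2 -> 'M[R]_m2}.
Context {al : 'rV[R]_m2 -> R} {be : 'rV[R]_m1 -> R} {G : 'rV[R]_n -> 'M[R]_n}.
Context (W : warped sp U1 U2 G1 G2 al be G).
Context {R1 R2 : R} {Phi : 'rV[R]_m1 -> R} {Psi : 'rV[R]_m2 -> R}.
Context {f : 'rV[R]_n -> R} (P : warped_potential sp U1 U2 al be R1 R2 Phi Psi f).
Context {y1 : 'rV[R]_m1} {y2 : 'rV[R]_m2} (Uy1 : U1 y1) (Uy2 : U2 y2).
Local Notation y := (join sp y1 y2).
Local Notation a := (log al).
Local Notation b := (log be).

(** The bracket is nonpositive and enters with the negative factor - (alpha^2 / beta^2) g_B(X, X),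
    so dropping it only lowers the block, however large the ratio of the warping functions is. *)
Lemma warped_block_ge eta X : 0 < R1 -> eta <= - (R1 ^+ 2 + R1) ->
  (forall Y, qform (G2 y2) Y = 1 -> R1 * qform (hessian_mx G2 a y2) Y
     <= eta * directional Psi Y y2 ^+ 2 + eta * directional a Y y2 ^+ 2) ->
  qform (ricci_mx G1 y1) X + qform (hessian_mx G1 Phi y1) X
    - R2 * qform (hessian_mx G1 b y1) X - m2%:R * directional b X y1 ^+ 2
  <= qform (mxsub (inL sp) (inL sp) (ricci_mx G y + hessian_mx G f y)) X.
Proof.
move=> R10 etaE aH.
have [_ pG1 _] := metricL W; have [_ pG2 _] := metricR W.
have := weighted_laplacian_le0 (pG2 _ Uy2) R10 etaE aH.
rewrite (qform_curvatureLL W P Uy1 Uy2) => L0.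
rewrite lerDl oppr_ge0 -mulrA mulr_ge0_le0 //.
  by rewrite mulr_ge0 ?invr_ge0 ?sqr_ge0.
by rewrite mulr_le0_ge0 // posdef_ge0 //; exact: pG1.
Qed.

End Estimate.

Lemma warped_bakry_emery_ge n m1 m2 (sp : @coord_split R n m1 m2) U1 U2 G1 G2 al be
    G R1 R2 Phi Psi f (W : warped sp U1 U2 G1 G2 al be G)
    (P : warped_potential sp U1 U2 al be R1 R2 Phi Psi f)
    y1 y2 (Uy1 : U1 y1) (Uy2 : U2 y2) (N KB KF : R)
    (v : 'rV[R]_n) (X : 'rV[R]_m1) (Y : 'rV[R]_m2) :
  (m1 + m2)%:R < N -> 0 < R1 -> 0 < R2 ->
  let eta := hessian_constant m1 m2 N R1 R2 in
  (forall X, (m1%:R - 1) * KB * qform (G1 y1) X <= qform (ricci_mx G1 y1) X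
     + qform (hessian_mx G1 Phi y1) X
     - (N - m1%:R)^-1 * directional Phi X y1 ^+ 2) ->
  (forall Y, (m2%:R - 1) * KF * qform (G2 y2) Y <= qform (ricci_mx G2 y2) Y
     + qform (hessian_mx G2 Psi y2) Y
     - (N - m2%:R)^-1 * directional Psi Y y2 ^+ 2) ->
  (forall X, qform (G1 y1) X = 1 -> R2 * qform (hessian_mx G1 (log be) y1) X
     <= eta * directional Phi X y1 ^+ 2 + eta * directional (log be) X y1 ^+ 2) ->
  (forall Y, qform (G2 y2) Y = 1 -> R1 * qform (hessian_mx G2 (log al) y2) Y
     <= eta * directional Psi Y y2 ^+ 2 + eta * directional (log al) Y y2 ^+ 2) ->
  (forall i, v ord0 (inL sp i) = X ord0 i) ->
  (forall p, v ord0 (inR sp p) = Y ord0 p) ->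
  Num.min ((m1%:R - 1) * al y2 ^- 2 * KB) ((m2%:R - 1) * be y1 ^- 2 * KF)
    * qform (G (join sp y1 y2)) v
  <= qform (ricci_mx G (join sp y1 y2)) v + qform (hessian_mx G f (join sp y1 y2)) v
     - (N - (m1 + m2)%:R)^-1 * directional f v (join sp y1 y2) ^+ 2.
Proof.
move=> N0 R10 R20 eta hB hF bH aH vL vR.
have W' := warped_flip W; have P' := warped_potential_flip P.
have [_ pG1 _] := metricL W; have [_ pG2 _] := metricR W.
set s := (N - (m1 + m2)%:R)^-1.
have s0 : 0 <= s by rewrite invr_ge0 subr_ge0 ltW.
pose C0 := 2 * (m1%:R + m2%:R) + 4 + `|m1%:R - R1| + `|m2%:R - R2|
  + 4 * s * ((m1%:R - R1) ^+ 2 + (m2%:R - R2) ^+ 2 + 2) : R.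
have C00 : 0 <= C0 by rewrite !addr_ge0 ?mulr_ge0 ?addr_ge0 ?sqr_ge0.
have etaE : eta = - (R1 ^+ 2 + R1 + (R2 ^+ 2 + R2) + C0) by [].
have RR0 (r : R) : 0 < r -> 0 <= r ^+ 2 + r by move=> r0; rewrite addr_ge0 ?sqr_ge0 ?ltW.
have eta1 : eta <= - (R1 ^+ 2 + R1) by rewrite etaE lerN2; have := RR0 _ R20; lra.
have eta2 : eta <= - (R2 ^+ 2 + R2) by rewrite etaE lerN2; have := RR0 _ R10; lra.
have etaC : eta <= - C0 by rewrite etaE lerN2; have := RR0 _ R10; have := RR0 _ R20; lra.
have HL := warped_block_ge W P Uy1 Uy2 X R10 eta1 aH.
have HR : _ <= qform (mxsub (inR sp) (inR sp) (ricci_mx G (join sp y1 y2)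
    + hessian_mx G f (join sp y1 y2))) Y := warped_block_ge W' P' Uy2 Uy1 Y R20 eta2 bH.
(* Second use of the Hessian bounds, now in the directions [X] and [Y] themselves. *)
have hb := hessian_bound_scale (pG1 _ Uy1) bH X.
have ha := hessian_bound_scale (pG2 _ Uy2) aH Y.
have qG : qform (G (join sp y1 y2)) v
    = al y2 ^+ 2 * qform (G1 y1) X + be y1 ^+ 2 * qform (G2 y2) Y.
  rewrite (qform_split _ vL vR) -[RHS]addr0; congr (_ + _).
    congr (_ + _); rewrite -qformZ; congr (qform _ _);
      by apply/matrixP => i j; rewrite !mxE ?(warpedLL W) ?(warpedRR W).
  rewrite big1 ?add0r => [|i _]; rewrite big1 // => j _.
    by rewrite big1 // => i _; rewrite (warpedRL W) // mulr0 mul0r.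
  by rewrite (warpedLR W) // mulr0 mul0r.
rewrite qG -qformD (qform_split _ vL vR) (bilinear_curvatureLR W P Uy1 Uy2).
have -> := bilinear_curvatureLR W' P' Uy2 Uy1 Y X.
rewrite (directional_potentialL W P Uy1) (directional_potentialR W P Uy2).
rewrite (directional_potential W P Uy1 Uy2 vL vR).
have al0 : al y2 != 0 by rewrite gt_eqF // (warpingR W).2.
have be0 : be y1 != 0 by rewrite gt_eqF // (warpingL W).2.
(* The square of the warping function in the product metric cancels the negative power inside the
   minimum. *)
have minL : Num.min ((m1%:R - 1) * al y2 ^- 2 * KB) ((m2%:R - 1) * be y1 ^- 2 * KF)
    * (al y2 ^+ 2 * qform (G1 y1) X) <= (m1%:R - 1) * KB * qform (G1 y1) X.
  rewrite mulrA ler_wpM2r ?posdef_ge0 //; first exact: pG1.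
  rewrite -[leRHS](mulfVK (expf_neq0 2 al0)) ler_wpM2r ?sqr_ge0 //.
  by rewrite [leRHS]mulrAC ge_min lexx.
have minR : Num.min ((m1%:R - 1) * al y2 ^- 2 * KB) ((m2%:R - 1) * be y1 ^- 2 * KF)
    * (be y1 ^+ 2 * qform (G2 y2) Y) <= (m2%:R - 1) * KF * qform (G2 y2) Y.
  rewrite mulrA ler_wpM2r ?posdef_ge0 //; first exact: pG2.
  rewrite -[leRHS](mulfVK (expf_neq0 2 be0)) ler_wpM2r ?sqr_ge0 //.
  by rewrite [leRHS]mulrAC ge_min lexx orbT.
have natB m : m%:R <= (m1 + m2)%:R :> R -> 0 <= (N - m%:R)^-1.
  by move=> le; rewrite invr_ge0 subr_ge0 (le_trans le) // ltW.
(* This square is subtracted in the curvature of B, so moving it to the other side of the hypothesis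
   leaves a lower bound for Ric + nabla^2 Phi. *)
have s1 : 0 <= (N - m1%:R)^-1 * directional Phi X y1 ^+ 2.
  by rewrite mulr_ge0 ?sqr_ge0 // natB // ler_nat leq_addr.
have s2 : 0 <= (N - m2%:R)^-1 * directional Psi Y y2 ^+ 2.
  by rewrite mulr_ge0 ?sqr_ge0 // natB // ler_nat leq_addl.
have := @mixed_terms_bound _ m1%:R m2%:R (m1%:R - R1) (m2%:R - R2) s
  (directional (log be) X y1) (directional Phi X y1)
  (directional (log al) Y y2) (directional Psi Y y2) _
  (ler0n R m1) (ler0n R m2) s0 erefl.
rewrite -/C0.
have := hB X; have := hF Y; move: s1 s2 minL minR HL HR hb ha.
(* All curvature quantities become variables; once the products of [eta] and of [C0] with the sum of
   squares are compared, the claim is a linear combination of the collected inequalities. *)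
move: (qform (mxsub (inL sp) _ _) X) (qform (mxsub (inR sp) _ _) Y) => qL qR.
move: (R2 * _) (R1 * _) (qform (ricci_mx G1 _) X + _) (qform (ricci_mx G2 _) Y + _) =>
  hessb hessa ricB ricF.
move: (qform (G1 y1) X) (qform (G2 y2) Y) (al y2) (be y1) => q1 q2 u v'.
move: (Num.min _ _) => mn.
move: (directional (log be) X y1) (directional Phi X y1) => xb xPhi.
move: (directional (log al) Y y2) (directional Psi Y y2) => ua uPsi.
have : eta * (xPhi ^+ 2 + xb ^+ 2 + (uPsi ^+ 2 + ua ^+ 2))
    <= - C0 * (xPhi ^+ 2 + xb ^+ 2 + (uPsi ^+ 2 + ua ^+ 2)).
  by rewrite ler_wpM2r // !addr_ge0 ?sqr_ge0.
move: eta C0 {hB hF bH aH etaE eta1 eta2 etaC C00} => eta C0.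
move: (N - m1%:R)^-1 (N - m2%:R)^-1 (s * _ ^+ 2) => *.
lra.
Qed.

End CurvatureEstimate.

(** * Product charts as instances of the abstract splitting *)

Section ProductCharts.
Context {R : realType}.

Lemma row_mx_deltaL n1 n2 (h : R) i (y1 : 'rV[R]_n1) (y2 : 'rV[R]_n2) :
  row_mx (h *: delta_mx ord0 i + y1) y2
  = h *: delta_mx ord0 (lshift n2 i) + row_mx y1 y2.
Proof. by rewrite delta_mx_lshift scale_row_mx scaler0 add_row_mx add0r. Qed.

Lemma row_mx_deltaR n1 n2 (h : R) p (y1 : 'rV[R]_n1) (y2 : 'rV[R]_n2) :
  row_mx y1 (h *: delta_mx ord0 p + y2)
  = h *: delta_mx ord0 (rshift n1 p) + row_mx y1 y2.
Proof. by rewrite delta_mx_rshift scale_row_mx scaler0 add_row_mx add0r. Qed.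

Definition block_split n1 n2 : @coord_split R (n1 + n2) n1 n2 :=
  @CoordSplit R (n1 + n2) n1 n2 (@lshift n1 n2) (@rshift n1 n2)
    (@row_mx R 1 n1 n2) (fun f => big_split_ord _ xpredT f) (@row_mx_deltaL n1 n2)
    (@row_mx_deltaR n1 n2).

Lemma riemannian_local_metric n (M : manifold R n) (c : chart M) :
  riemannian M -> local_metric (chart_im c) (metric M c).
Proof.
move=> [[_ [_ [_ [chartM _]]]] [smoothg [symg [posg _]]]].
split; first by case: (chartM c).
  by move=> y cy; split; [exact: symg|move=> v v0; exact: posg].
by move=> i j; exact: smoothg.
Qed.

Context {n1 n2 : nat} {B : manifold R n1} {F : manifold R n2}.
Context {alpha : F -> R} {beta : B -> R} (cB : chart B) (cF : chart F).
Local Notation al := (in_chart cF alpha).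
Local Notation be := (in_chart cB beta).

Lemma doubly_warped_local : riemannian B -> riemannian F ->
  smooth alpha -> (forall q, 0 < alpha q) ->
  smooth beta -> (forall z, 0 < beta z) ->
  warped (block_split n1 n2) (chart_im cB) (chart_im cF)
    (metric B cB) (metric F cF) al be (metric (doubly_warped B F alpha beta) (cB, cF)).
Proof.
move=> /(riemannian_local_metric cB) mB /(riemannian_local_metric cF) mF.
move=> salpha alpha0 sbeta beta0.
have metricE y1 y2 : metric (doubly_warped B F alpha beta) (cB, cF) (row_mx y1 y2)
    = block_mx (al y2 ^+ 2 *: metric B cB y1) 0 0 (be y1 ^+ 2 *: metric F cF y2).
  by rewrite /= row_mxKl row_mxKr.
have invE y1 y2 : chart_im cB y1 -> chart_im cF y2 ->
    invmx (metric (doubly_warped B F alpha beta) (cB, cF) (row_mx y1 y2))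
    = block_mx (al y2 ^- 2 *: invmx (metric B cB y1)) 0
               0 (be y1 ^- 2 *: invmx (metric F cF y2)).
  move=> By Fy; have [_ /(_ _ By) pB _] := mB; have [_ /(_ _ Fy) pF _] := mF.
  have ual : al y2 ^+ 2 \is a GRing.unit.
    by rewrite unitfE expf_neq0 // gt_eqF //; exact: alpha0.
  have ube : be y1 ^+ 2 \is a GRing.unit.
    by rewrite unitfE expf_neq0 // gt_eqF //; exact: beta0.
  have uB := posdef_unit pB; have uF := posdef_unit pF.
  rewrite metricE invmx_block_diag ?block_diag_mx_unit ?unitmxZ ?uB ?uF //.
  by rewrite !invmxZ ?unitmxZ.
split=> //.
- by split=> [|y _]; [exact: sbeta|exact: beta0].
- by split=> [|y _]; [exact: salpha|exact: alpha0].
- by move=> y1 y2 i j _ _; rewrite [join _ _ _]/= metricE block_mxEul mxE.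
- by move=> y1 y2 i j _ _; rewrite [join _ _ _]/= metricE block_mxEdr mxE.
- by move=> y1 y2 i j _ _; rewrite [join _ _ _]/= metricE block_mxEur mxE.
- by move=> y1 y2 i j _ _; rewrite [join _ _ _]/= metricE block_mxEdl mxE.
- by move=> y1 y2 i j By Fy; rewrite [join _ _ _]/= invE // block_mxEul mxE.
- by move=> y1 y2 i j By Fy; rewrite [join _ _ _]/= invE // block_mxEdr mxE.
- by move=> y1 y2 i j By Fy; rewrite [join _ _ _]/= invE // block_mxEur mxE.
- by move=> y1 y2 i j By Fy; rewrite [join _ _ _]/= invE // block_mxEdl mxE.
Qed.

Lemma warped_weight_local R1 R2 (Phi : B -> R) (Psi : F -> R) :
  smooth Phi -> smooth Psi ->
  warped_potential (block_split n1 n2) (chart_im cB) (chart_im cF) al be R1 R2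
    (in_chart cB Phi) (in_chart cF Psi)
    (@in_chart R _ (doubly_warped B F alpha beta) (cB, cF)
       (warped_weight B F alpha beta R1 R2 Phi Psi)).
Proof.
move=> sPhi sPsi; split; [exact: sPhi|exact: sPsi|move=> y1 y2 _ _].
rewrite /in_chart /= /warped_weight /= row_mxKl row_mxKr /log /=.
by ring.
Qed.

End ProductCharts.

(** * Passage from charts to the manifolds *)

Theorem corollary1p9 (R : realType) (n1 n2 : nat) (N R1 R2 K1 K2 : R) :
  (0 < n1)%N -> (0 < n2)%N -> (n1 + n2)%:R < N -> 0 < R1 -> 0 < R2 ->
  exists eta : R,
  forall (B : manifold R n1) (F : manifold R n2)
    (Phi : B -> R) (Psi : F -> R) (alpha : F -> R) (beta : B -> R),
  weighted_riemannian B Phi -> weighted_riemannian F Psi ->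
  smooth alpha -> (forall q, 0 < alpha q) ->
  smooth beta -> (forall y, 0 < beta y) ->
  let a : F -> R := fun q => ln (alpha q) in
  let b : B -> R := fun y => ln (beta y) in
  let P := doubly_warped B F alpha beta in
  let chi := warped_weight B F alpha beta R1 R2 Phi Psi in
  forall (x : B) (p : F) (KB KF : R),
  (forall X : tangent x, (n1%:R - 1) * KB * g_sq X <= bakry_emery N Phi X) ->
  (forall U : tangent p, (n2%:R - 1) * KF * g_sq U <= bakry_emery N Psi U) ->
  (forall X : tangent x, unit_tangent X ->
     R2 * hess b X <= eta * dirder Phi X ^+ 2 + eta * dirder b X ^+ 2) ->
  (forall U : tangent p, unit_tangent U ->
     R1 * hess a U <= eta * dirder Psi U ^+ 2 + eta * dirder a U ^+ 2) ->
  forall Z : @tangent R (n1 + n2) P (x, p),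
    Num.min ((n1%:R - 1) * alpha p ^- 2 * KB) ((n2%:R - 1) * beta x ^- 2 * KF)
      * g_sq Z <= bakry_emery N chi Z.
Proof.
move=> _ _ N0 R10 R20; exists (hessian_constant n1 n2 N R1 R2).
move=> B F Phi Psi alpha beta [rB _ sPhi] [rF _ sPsi] salpha alpha0 sbeta beta0.
(* The tangent vector brings its own product chart [(cB, cF)]; the hypotheses are later applied to
   tangent vectors of the factors represented in [cB] and [cF]. *)
move=> a b P chi x p KB KF hB hF bH aH [[cB cF] dom v].
have [/= domB domF] : chart_dom B cB x /\ chart_dom F cF p := dom.
have imB : chart_im cB (chart_map B cB x) by exists x.
have imF : chart_im cF (chart_map F cF p) by exists p.
have W := doubly_warped_local cB cF rB rF salpha alpha0 sbeta beta0.
have wP := warped_weight_local (alpha := alpha) (beta := beta) cB cF R1 R2 sPhi sPsi.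
have alE : alpha p = in_chart cF alpha (chart_map F cF p).
  case: rF => [[_ [_ [_ [chartF _]]]] _]; have [_ _ invK _ _] := chartF cF.
  by rewrite /in_chart /= invK.
have beE : beta x = in_chart cB beta (chart_map B cB x).
  case: rB => [[_ [_ [_ [chartB _]]]] _]; have [_ _ invK _ _] := chartB cB.
  by rewrite /in_chart /= invK.
have := @warped_bakry_emery_ge R _ _ _ _ _ _ _ _ _ _ _ _ _ _ _ _ W wP
  _ _ imB imF N KB KF v (lsubmx v) (rsubmx v) N0 R10 R20
  (fun X => hB (Tangent domB X)) (fun Y => hF (Tangent domF Y))
  (fun X => bH (Tangent domB X)) (fun Y => aH (Tangent domF Y)).
rewrite -alE -beE; apply=> i; by rewrite mxE.
Qed.
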